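(* Consider polygons $$\overline\Delta(\kappa)=\{x\in\mathbb R^2:\ x_1\ge0,\ x_2\ge0,\ -8x_1-5x_2+40\ge0,\ \langle\eta_j,x\rangle+\kappa_j\ge0\ (j=4,\dots,8)\}$$ with $\eta_4=(-1,-1)$, $\eta_5=(-3,-2)$, $\eta_6=(-5,-3)$, $\eta_7=(-2,-1)$, $\eta_8=(-1,0)$. For all support constants $\kappa_4<8$, $\kappa_5<16$, $\kappa_6<25$, $\kappa_7<10$, $\kappa_8<5$ sufficiently close to these upper bounds and such that $\overline\Delta(\kappa)$ has eight edges, so that $\overline\Delta(\kappa)$ is the moment polytope of a full minimal resolution of the weighted projective plane $\mathbb P(1,5,8)$, there is a nonempty open set of points in $\mathrm{Int}\,\overline\Delta(\kappa)$ which have trivial qW invariants and cannot be displaced by extended probes.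
   Context: $\mathbb P(1,5,8)$ has moment polytope the triangle with vertices $(0,0),(5,0),(0,8)$. qW invariants. Let $\Lambda$ be the field of series $\sum_{d\in\mathbb R}a_dq^d$, $a_d\in\mathbb C$, with $\{d:a_d\neq0\}$ discrete and bounded below, with valuation $\nu(\sum a_dq^d)=\min\{d:a_d\ne0\}$, and $\Lambda_0=\{\nu\ge0\}$. A presentation of a polygon $\Delta$ is $\Delta=\{x:\ell_i(x)=\langle\eta_i,x\rangle+\kappa_i\ge0,\ i=1,\dots,N\}$, $\eta_i\in\mathbb Z^2$, containing the inequalities of the actual facets and possibly finitely many ghost facets, i.e. inequalities with $\ell_i>0$ on $\Delta\setminus f$ for some (possibly empty) face $f$ of dimension $<1$. For $x\in\mathrm{Int}\,\Delta$, $\alpha\in\Lambda_0^N$, put $W_{x,\alpha}(\beta)=\sum_{i=1}^N\exp(\langle\eta_i,\beta\rangle+\alpha_i)q^{\ell_i(x)}$, $\beta\in\Lambda_0^2$. The point $x$ has nontrivial qW invariants if for some presentation and some $\alpha$ the function $W_{x,\alpha}$ has a critical point $\beta\in\Lambda_0^2$ (all $\partial_{\beta_j}W_{x,\alpha}(\beta)=0$), and trivial qW invariants otherwise. Extended probes in a rational polygon $\Delta$ (facets $F\subset\{\langle\eta_F,x\rangle+\kappa_F=0\}$, $\eta_F$ primitive interior conormal). If $x-y=tv$ with $v$ primitive integral, $d_{\mathrm{aff}}(x,y)=|t|$; $d_{\mathrm{aff}}(x,F)=|\langle\eta_F,x\rangle+\kappa_F|$; $d_v(x,F)$ is the $t\ge0$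 with $x+tv$ on the affine line spanned by $F$ ($\infty$ if the ray misses it). A probe $P$ is a directed segment in $\Delta$ from $b_P$ in the interior of a facet $F_P$ to $b_P+\ell(P)v_P$, with $v_P\in\mathbb Z^2$ primitive and $\langle\eta_{F_P},v_P\rangle=1$; $\ell(P)$ is its length. A point $u\in\mathrm{Int}\,\Delta$ can be displaced by extended probes if one of the following holds: (a) $u\in P$ for a probe $P$ and $d_{\mathrm{aff}}(u,F_P)<\frac12\ell(P)$. (b) There are a symmetric probe $Q$ (its endpoint lies in the interior of a facet $F_Q'$ with $\langle\eta_{F_Q'},v_Q\rangle=-1$), with affine reflection $A_Q(x)=x+\langle\eta_{F_Q'}-\eta_{F_Q},x\rangle v_Q+(\kappa_{F_Q'}-\kappa_{F_Q})v_Q$ and linear part $\widehat A_Q$, a probe $P$ ending at $x_{PQ}$ in the interior of $Q$, and a segment $P'\subset\Delta$ from $x_{PQ}'=A_Q(x_{PQ})$ to $x'_{PQ}+\ell(P')\widehat A_Q(v_P)$, such that either $u\in\mathrm{Int}\,P$ and $d_{\mathrm{aff}}(u,F_P)<\frac12(\ell(P)+\ell(P'))$, or $u\in\mathrm{Int}\,P'$ and $\ell(P)+d_{\mathrm{aff}}(x'_{PQ},u)<\frac12(\ell(P)+\ell(P'))$. (c) There are probes $P,Q$ with $P$ ending at $x_{PQ}\in Q$, $\mu\in[0,1]$, points $x_{\mathcal F},x'_{\mathcal F}\in Q$ with $x_{\mathcal F}$ closer to $b_Q$, and $\ell(\mathcal F)\ge0$, such that with $e_{\mathcal F}=x_{\mathcal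 F}+\ell(\mathcal F)(v_P-(1+\mu)\langle\eta_{F_Q},v_P\rangle v_Q)$ and $e'_{\mathcal F}=x'_{\mathcal F}+\ell(\mathcal F)(v_P-\mu\langle\eta_{F_Q},v_P\rangle v_Q)$ the convex hull of $x_{\mathcal F},x'_{\mathcal F},e_{\mathcal F},e'_{\mathcal F}$ lies in $\Delta$, $[x_{\mathcal F},e_{\mathcal F}]$ and $[x'_{\mathcal F},e'_{\mathcal F}]$ do not cross, $u\in\mathrm{Int}\,P$, $d_{\mathrm{aff}}(u,F_P)<\frac12(\ell(P)+\ell(\mathcal F))$, $d_{\mathrm{aff}}(x_{PQ},F_Q)<d_{\mathrm{aff}}(x_{\mathcal F},x'_{\mathcal F})$ and $\ell(\mathcal F)<d_{v_P}(x_{PQ},F_Q)$ (this includes the parallel case $\langle\eta_{F_Q},v_P\rangle=0$). *)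

(* Defs.v *)
From HB Require Import structures.
From mathcomp Require Import all_boot all_order all_algebra complex.
From mathcomp Require Import all_classical all_reals all_analysis.

Set Implicit Arguments.
Unset Strict Implicit.
Unset Printing Implicit Defensive.

Import Order.TTheory GRing.Theory Num.Theory.
Import numFieldNormedType.Exports.

Local Open Scope classical_set_scope.
Local Open Scope ring_scope.

Section LatticePlane.
Variable R : realType.

Definition ivec (a b : int) : 'rV[int]_2 :=
  \row_(j < 2) (if j == ord0 then a else b).

Definition to_plane (v : 'rV[int]_2) : 'rV[R]_2 := map_mx intr v.

Definition pairing (eta : 'rV[int]_2) (x : 'rV[R]_2) : R :=
  \sum_(j < 2) (eta ord0 j)%:~R * x ord0 j.

Definition ell (eta : 'rV[int]_2) (kappa : R) (x : 'rV[R]_2) : R :=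
  pairing eta x + kappa.

Definition primitive (v : 'rV[int]_2) : bool :=
  coprimez (v ord0 ord0) (v ord0 ord_max).

Definition seg (b w : 'rV[R]_2) (l : R) : set 'rV[R]_2 :=
  [set x | exists2 t : R, 0 <= t <= l & x = b + t *: w].

Definition open_seg (b w : 'rV[R]_2) (l : R) : set 'rV[R]_2 :=
  [set x | exists2 t : R, 0 < t < l & x = b + t *: w].

Definition conv_hull (n : nat) (p : 'I_n -> 'rV[R]_2) : set 'rV[R]_2 :=
  [set x | exists w : 'I_n -> R,
    [/\ forall i, 0 <= w i, \sum_i w i = 1 & x = \sum_i w i *: p i]].

(* Only meaningful when x - y is a multiple of an integral vector; v is then
   unique up to sign unless x = y. The junk value elsewhere is 0. *)
Definition daff (x y : 'rV[R]_2) : R :=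
  xget 0 [set t : R | exists (v : 'rV[int]_2) (s : R),
    [/\ primitive v, x - y = s *: to_plane v & t = `|s|]].

Definition daff_facet (x : 'rV[R]_2) (eta : 'rV[int]_2) (kappa : R) : R :=
  `|ell eta kappa x|.

(* The infimum is over at most one value, unless the ray lies in the line; it
   is +oo when the ray misses the line. *)
Definition ddir_facet (v : 'rV[int]_2) (x : 'rV[R]_2) (eta : 'rV[int]_2)
    (kappa : R) : \bar R :=
  ereal_inf [set t%:E | t in
    [set t : R | 0 <= t /\ ell eta kappa (x + t *: to_plane v) = 0]].

End LatticePlane.

Section Polygons.
Variable R : realType.
Implicit Types (D : set 'rV[R]_2) (eta : 'rV[int]_2) (kappa : R).

Definition facet_set D eta kappa : set 'rV[R]_2 :=
  D `&` [set x | ell eta kappa x = 0].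

(* For a two-dimensional polygon D with rational edges: eta is the primitive
   interior conormal of an edge and kappa its support constant. *)
Definition is_facet D eta kappa : Prop :=
  [/\ primitive eta,
      forall x, D x -> 0 <= ell eta kappa x
    & exists x y, [/\ facet_set D eta kappa x, facet_set D eta kappa y
                    & x <> y]].

Definition edges D : set (set 'rV[R]_2) :=
  [set F | exists eta kappa, is_facet D eta kappa /\ F = facet_set D eta kappa].

Definition facet_interior D eta kappa : set 'rV[R]_2 :=
  [set x | exists y z, [/\ facet_set D eta kappa y, facet_set D eta kappa z,
     y <> z & exists2 t : R, 0 < t < 1 & x = (1 - t) *: y + t *: z]].

(* Exposed faces; this includes the empty face and D itself. *)
Definition is_face D (f : set 'rV[R]_2) : Prop :=
  exists (c : 'rV[R]_2) (k : R),
    let h x := \sum_(j < 2) c ord0 j * x ord0 j + k in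
    (forall x, D x -> 0 <= h x) /\ f = D `&` [set x | h x = 0].

Definition is_ghost D eta kappa : Prop :=
  exists f : set 'rV[R]_2, [/\ is_face D f, is_subset1 f &
    forall x, (D `\` f) x -> 0 < ell eta kappa x].

(* Every actual facet is listed exactly once: a repeated facet would allow its
   term in the potential to be cancelled. *)
Definition is_presentation D (N : nat) (eta : 'I_N -> 'rV[int]_2)
    (kappa : 'I_N -> R) : Prop :=
  [/\ D = [set x | forall i, 0 <= ell (eta i) (kappa i) x],
      forall e k, is_facet D e k ->
        exists! i : 'I_N, eta i = e /\ kappa i = k
    & forall i, is_facet D (eta i) (kappa i) \/ is_ghost D (eta i) (kappa i)].

End Polygons.

Section Novikov.
Variable R : realType.

(* The coefficient of q^d in a is a d. Elements of the Novikov field are the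
   functions satisfying [novikov]; the ring product of series is [nov_mul],
   not the pointwise product. *)
Definition qseries : Type := R -> R[i].

Definition novikov (a : qseries) : Prop :=
  forall E : R, finite_set [set d : R | d <= E /\ a d != 0].

(* The set is locally finite for novikov a, so the infimum is a minimum if
   a != 0; nu 0 = +oo. *)
Definition nu (a : qseries) : \bar R :=
  ereal_inf [set d%:E | d in [set d : R | a d != 0]].

Definition Lambda0 (a : qseries) : Prop := novikov a /\ (0%:E <= nu a)%E.

Definition nov_add (a b : qseries) : qseries := fun d => a d + b d.

Definition nov_sub (a b : qseries) : qseries := fun d => a d - b d.

Definition nov_const (c : R[i]) : qseries := fun d => if d == 0 then c else 0.

Definition nov_q (e : R) : qseries := fun d => if d == e then 1 else 0.

(* For novikov a and b each of these sums has finite support. *)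
Definition nov_mul (a b : qseries) : qseries :=
  fun d => \sum_(e \in [set: R]) (a e * b (d - e)).

Definition nov_pow (a : qseries) (n : nat) : qseries :=
  iter n (nov_mul a) (nov_const 1).

Definition complex_exp (z : R[i]) : R[i] :=
  Complex (expR (complex.Re z) * cos (complex.Im z))
          (expR (complex.Re z) * sin (complex.Im z)).

(* For a in Lambda0 write a = a_0 + a_+ with nu a_+ > 0. Then
   exp a = exp a_0 * \sum_n a_+^n / n!, where exp a_0 is the complex
   exponential and only finitely many n contribute to each coefficient. *)
Definition nov_exp (a : qseries) : qseries :=
  let a_plus : qseries := fun d => if d == 0 then 0 else a d in
  fun d => complex_exp (a 0) *
    \sum_(n \in [set: nat]) ((n`!%:R)^-1 * nov_pow a_plus n d).

Definition nov_pairing (eta : 'rV[int]_2) (beta : 'I_2 -> qseries) : qseries :=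
  fun d => \sum_(j < 2) beta j d *~ eta ord0 j.

(* D is the j-th partial derivative at beta, for the topology on Lambda0
   induced by the valuation: f (beta + h e_j) - f beta - D h = o(h). *)
Definition is_partial (f : ('I_2 -> qseries) -> qseries) (beta : 'I_2 -> qseries)
    (j : 'I_2) (D : qseries) : Prop :=
  forall E : R, exists M : R, forall h : qseries,
    Lambda0 h -> (M%:E <= nu h)%E ->
    let beta_h := fun k => if k == j then nov_add (beta k) h else beta k in
    (E%:E + nu h
       <= nu (nov_sub (nov_sub (f beta_h) (f beta)) (nov_mul D h)))%E.

Definition potential (N : nat) (eta : 'I_N -> 'rV[int]_2) (kappa : 'I_N -> R)
    (x : 'rV[R]_2) (alpha : 'I_N -> qseries) (beta : 'I_2 -> qseries) : qseries :=
  fun d => \sum_(i < N)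
    nov_mul (nov_exp (nov_add (nov_pairing (eta i) beta) (alpha i)))
            (nov_q (ell (eta i) (kappa i) x)) d.

Definition critical_point (f : ('I_2 -> qseries) -> qseries)
    (beta : 'I_2 -> qseries) : Prop :=
  (forall j, Lambda0 (beta j)) /\ forall j, is_partial f beta j (nov_const 0).

Definition nontrivial_qW (D : set 'rV[R]_2) (x : 'rV[R]_2) : Prop :=
  exists (N : nat) (eta : 'I_N -> 'rV[int]_2) (kappa : 'I_N -> R)
         (alpha : 'I_N -> qseries) (beta : 'I_2 -> qseries),
    [/\ is_presentation D eta kappa, forall i, Lambda0 (alpha i)
      & critical_point (potential eta kappa x alpha) beta].

Definition trivial_qW (D : set 'rV[R]_2) (x : 'rV[R]_2) : Prop :=
  ~ nontrivial_qW D x.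

End Novikov.

Section Probes.
Variable R : realType.
Implicit Types (D : set 'rV[R]_2) (u : 'rV[R]_2).

Record probe := Probe {
  pnormal : 'rV[int]_2;
  pconst : R;
  pbase : 'rV[R]_2;
  pdir : 'rV[int]_2;
  plen : R }.

Implicit Types P Q : probe.

Definition pvec P : 'rV[R]_2 := to_plane R (pdir P).

Definition pend P : 'rV[R]_2 := pbase P + plen P *: pvec P.

Definition probe_set P : set 'rV[R]_2 := seg (pbase P) (pvec P) (plen P).

Definition probe_int P : set 'rV[R]_2 := open_seg (pbase P) (pvec P) (plen P).

Definition is_probe D P : Prop :=
  [/\ is_facet D (pnormal P) (pconst P),
      facet_interior D (pnormal P) (pconst P) (pbase P),
      primitive (pdir P) /\ pairing (pnormal P) (pvec P) = 1
    & 0 < plen P /\ probe_set P `<=` D].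

Definition is_symmetric_probe D Q (eta' : 'rV[int]_2) (kappa' : R) : Prop :=
  [/\ is_probe D Q, is_facet D eta' kappa',
      facet_interior D eta' kappa' (pend Q) & pairing eta' (pvec Q) = -1].

Definition refl_lin Q (eta' : 'rV[int]_2) (w : 'rV[R]_2) : 'rV[R]_2 :=
  w + pairing (eta' - pnormal Q) w *: pvec Q.

Definition refl Q (eta' : 'rV[int]_2) (kappa' : R) (x : 'rV[R]_2) : 'rV[R]_2 :=
  refl_lin Q eta' x + (kappa' - pconst Q) *: pvec Q.

Definition displaced_by_probe D u : Prop :=
  exists P, [/\ is_probe D P, probe_set P u
    & daff_facet u (pnormal P) (pconst P) < plen P / 2].

Definition displaced_by_symmetric D u : Prop :=
  exists Q (eta' : 'rV[int]_2) (kappa' : R) P (l' : R),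
    let x' := refl Q eta' kappa' (pend P) in
    let w' := refl_lin Q eta' (pvec P) in
    [/\ is_symmetric_probe D Q eta' kappa',
        is_probe D P /\ probe_int Q (pend P),
        0 <= l' /\ seg x' w' l' `<=` D
      & (probe_int P u /\
           daff_facet u (pnormal P) (pconst P) < (plen P + l') / 2) \/
        (open_seg x' w' l' u /\ plen P + daff x' u < (plen P + l') / 2)].

Definition displaced_by_flag D u : Prop :=
  exists P Q (mu : R) (x x' : 'rV[R]_2) (l : R),
    let c := pairing (pnormal Q) (pvec P) in
    let w := pvec P - ((1 + mu) * c) *: pvec Q in
    let w' := pvec P - (mu * c) *: pvec Q in
    [/\ [/\ is_probe D P, is_probe D Q & probe_set Q (pend P)],
        [/\ 0 <= mu <= 1, 0 <= l, probe_set Q x, probe_set Q x'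
          & daff (pbase Q) x < daff (pbase Q) x'],
        conv_hull (tnth [tuple x; x'; x + l *: w; x' + l *: w']) `<=` D /\
        seg x w l `&` seg x' w' l = set0,
        probe_int P u /\ daff_facet u (pnormal P) (pconst P) < (plen P + l) / 2
      & daff_facet (pend P) (pnormal Q) (pconst Q) < daff x x' /\
        (l%:E < ddir_facet (pdir P) (pend P) (pnormal Q) (pconst Q))%E].

Definition displaceable_by_extended_probes D u : Prop :=
  [\/ displaced_by_probe D u, displaced_by_symmetric D u
    | displaced_by_flag D u].

End Probes.

Definition Delta_bar (R : realType) (k4 k5 k6 k7 k8 : R) : set 'rV[R]_2 :=
  [set x : 'rV[R]_2 |
    [/\ 0 <= x ord0 ord0, 0 <= x ord0 ord_max
      & 0 <= -8 * x ord0 ord0 - 5 * x ord0 ord_max + 40] /\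
    [/\ 0 <= ell (ivec (-1) (-1)) k4 x, 0 <= ell (ivec (-3) (-2)) k5 x,
        0 <= ell (ivec (-5) (-3)) k6 x, 0 <= ell (ivec (-2) (-1)) k7 x
      & 0 <= ell (ivec (-1) 0) k8 x]].

(* Main.v *)
Require Import Defs.
From HB Require Import structures.
From mathcomp Require Import all_boot all_order all_algebra complex.
From mathcomp Require Import all_classical all_reals all_analysis.
From mathcomp Require Import ring lra zify.

Set Implicit Arguments.
Unset Strict Implicit.
Unset Printing Implicit Defensive.

Import Order.TTheory GRing.Theory Num.Theory.
Import numFieldNormedType.Exports.

Local Open Scope classical_set_scope.
Local Open Scope ring_scope.

(** As the support constants tend to their upper bounds, the polygon tends to
    the triangle with corners (0, 0), (5, 0) and (0, 8): the five new facets cut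
    off small pieces at the last two corners, called A and B below. The open set
    is a small ball around (23/10, 19/5).

    Trivial qW invariants. From every point u of the ball the facet with
    conormal (-3, -2) is nearer than any other integral half plane containing
    the polygon: an integral affine function that is nonnegative at three points
    next to the corners and no larger at u than the one of this facet is
    constant or has the same linear part ([small_covector]). It is an actual
    facet because there are eight inequalities and eight edges
    ([all_facets_half_planes]). In the potential of any presentation its term
    therefore has strictly the lowest exponent among the terms that depend on
    beta. Moving beta by q^M changes it by a nonzero multiple of q^M times its
    leading monomial, which no other term can compensate, so that the derivative
    does not vanish ([trivial_qW_unique_nearest]).

    Displacement by probes rests on integrality. On a probe P through u the
    parameter of u is the distance t from u to the facet of P, and the base, t
    steps back from u, must lie in the polygon. This bounds the direction of P
    so well that only four integral directions remain ([probes_through_centre]),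
    and on these four lines the point with parameter 2 t lies outside the
    triangle ([ahead_of_centre]). Hence u is never in the first half of a probe.

    Symmetric probes. Both ends lie on facets and their equations determine the
    direction. Such a probe stays close to A or to B, or is of one of six kinds
    with a reflection given by an explicit formula ([symmetric_probeP]). If u
    lies on P before the reflection, then P meets the symmetric probe well away
    from the corners, which leaves only the probes along the slanted side; their
    reflection preserves the distance to that side and cannot prevent P from
    crossing it ([not_displaced_before_reflection]). If u lies after the
    reflection, then the point of the line of P that is reflected to u has as
    parameter the length travelled so far, so the mirror image in u of the
    reflected base belongs to the polygon; linear inequalities and integrality
    exclude every facet for the base ([not_displaced_after_reflection]).

    Flags. A flag is a trapezoid with two sides parallel to Q. Its existence
    forces the straight continuation of P to stay on the inner side of the facet
    of Q and to come back into the polygon under a positive multiple of the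
    direction of Q ([flag_tip]). At parameter 2 t the continuation has crossed
    the slanted side and three of the cuts, so the direction of Q descends away
    from the slanted side; no facet admits such a probe Q meeting P beyond u
    ([not_displaced_by_flag]). *)

(** * Novikov series *)

Lemma positive_lower_bound (R : realDomainType) (T : eqType) (s : seq T)
    (f : T -> R) :
  (forall x, x \in s -> 0 < f x) ->
  exists2 e : R, 0 < e & forall x, x \in s -> e <= f x.
Proof.
elim: s => [|y s IH] fpos; first by exists 1.
have [x xs|e e0 le_e] := IH; first by apply: fpos; rewrite inE xs orbT.
exists (Num.min e (f y)); first by rewrite lt_min e0 fpos ?mem_head.
move=> x; rewrite inE => /predU1P[->|/le_e]; rewrite ge_min ?lexx ?orbT //.
by move=> ->.
Qed.

Section Novikov.
Variable R : realType.
Implicit Types (a b : qseries R) (d M : R).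

Lemma fsum_single (T : choiceType) (V : nmodType) (F : T -> V) (x : T) :
  (forall y, y != x -> F y = 0) -> \sum_(y \in [set: T]) F y = F x.
Proof.
move=> F0; rewrite (fsbigE [:: x]) //= ?big_cons ?big_nil ?in_setT ?addr0 //.
by move=> y _; rewrite inE; apply: F0.
Qed.

Lemma nu_geP a M : (M%:E <= nu a)%E <-> forall d, d < M -> a d = 0.
Proof.
split=> [leM d|a0].
  apply: contraTeq => ad0; rewrite -leNgt -lee_fin (le_trans leM) //.
  by apply: ereal_inf_lbound; exists d.
apply: le_ereal_inf_tmp => _ [d /= ad0 <-]; rewrite lee_fin leNgt.
by apply: contra_neqN ad0; apply: a0.
Qed.

Lemma nu_le a d : a d != 0 -> (nu a <= d%:E)%E.
Proof. by move=> ad0; apply: ereal_inf_lbound; exists d. Qed.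

Lemma nu_q M : nu (nov_q M) = M%:E.
Proof.
apply/eqP; rewrite eq_le nu_le ?/nov_q ?eqxx ?oner_neq0 //=.
by apply/nu_geP => d dM; rewrite lt_eqF.
Qed.

Lemma Lambda0_q M : 0 <= M -> Lambda0 (nov_q M).
Proof.
move=> M0; split; last by rewrite nu_q lee_fin.
move=> E; apply: sub_finite_set (finite_set1 M) => d [_].
by rewrite /nov_q; case: (eqVneq d M) => [-> //|_]; rewrite eqxx.
Qed.

Lemma Lambda0_lt0 a d : Lambda0 a -> d < 0 -> a d = 0.
Proof. by case=> _ /nu_geP; apply. Qed.

(** Discreteness of the exponents: this is what makes the exponential series
    of the positive part finite in each degree. *)
Lemma Lambda0_gap a : Lambda0 a ->
  exists2 e : R, 0 < e & forall d, 0 < d < e -> a d = 0.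
Proof.
case=> /(_ 1) /finite_seqP[X defX] _.
have pos x : x \in [seq d <- X | 0 < d] -> 0 < id x.
  by rewrite mem_filter => /andP[].
have [e e0 le_e] := positive_lower_bound pos.
exists (Num.min e 1) => [|d /andP[d0]]; first by rewrite lt_min e0 ltr01.
rewrite lt_min => /andP[de d1]; apply: contraTeq de => ad0.
rewrite -leNgt; apply: le_e; rewrite mem_filter d0.
have: [set d | d <= 1 /\ a d != 0] d by split; rewrite ?ltW.
by rewrite defX.
Qed.

Lemma nov_mul_q a M d : nov_mul a (nov_q M) d = a (d - M).
Proof.
rewrite /nov_mul (@fsum_single _ _ _ (d - M)).
  by rewrite /nov_q subKr eqxx mulr1.
move=> e ne; rewrite /nov_q (_ : _ == M = false) ?mulr0 //.
by apply: contra_neqF ne => /eqP <-; rewrite subKr.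
Qed.

Lemma nov_mul_const1 a : nov_mul a (nov_const 1) = a.
Proof.
apply/funext => d; rewrite /nov_mul (@fsum_single _ _ _ d).
  by rewrite /nov_const subrr eqxx mulr1.
by move=> e ne; rewrite /nov_const subr_eq0 eq_sym (negPf ne) mulr0.
Qed.

Lemma nov_mul_const0 b : nov_mul (nov_const 0) b = fun=> 0.
Proof.
by apply/funext => d; apply: fsbig1 => e _; rewrite /nov_const if_same mul0r.
Qed.

Lemma nov_powS a n : nov_pow a n.+1 = nov_mul a (nov_pow a n).
Proof. by []. Qed.

Lemma nov_pow_low a (e : R) n d :
  (forall d, d < e -> a d = 0) -> d < n%:R * e -> nov_pow a n d = 0.
Proof.
move=> a0; elim: n d => [|n IH] d.
  by rewrite mul0r => /lt_eqF; rewrite /= /nov_const => ->.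
move=> dlt; rewrite nov_powS; apply: fsbig1 => f _.
have [/a0 ->|ef] := ltP f e; first by rewrite mul0r.
rewrite IH ?mulr0 // ltrBlDr (lt_le_trans dlt) // -natr1 mulrDl mul1r.
by rewrite lerD2l.
Qed.

Lemma nov_pow_lt0 a n d :
  (forall d, d <= 0 -> a d = 0) -> d < 0 -> nov_pow a n d = 0.
Proof.
move=> a0 d0; apply: (@nov_pow_low a 0) => [f /ltW|]; first exact: a0.
by rewrite mulr0.
Qed.

(** In a power with more than one factor the increment is multiplied by a term
    of positive exponent, so it shows only above M. *)
Lemma nov_pow_perturb a (c : R[i]) M n d :
    (forall d, d <= 0 -> a d = 0) -> 0 < M -> d <= M ->
  nov_pow (fun d => a d + (if d == M then c else 0)) n d
  = nov_pow a n d + (if (d == M) && (n == 1%N) then c else 0).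
Proof.
move=> a0 M0; set a' := fun d => _.
have a'0 f : f <= 0 -> a' f = 0.
  by move=> f0; rewrite /a' a0 // lt_eqF ?addr0 // (le_lt_trans f0).
elim: n d => [|n IH] d dM; first by rewrite andbF addr0.
case: n => [|n] in IH *.
  by rewrite /= !nov_mul_const1 /a' andbT.
rewrite andbF addr0 (nov_powS a') (nov_powS a); apply: eq_fsbigr => f _.
have [f0|f0] := leP f 0; first by rewrite a'0 // a0 // !mul0r.
rewrite {1}/a'; case: (eqVneq f M) => [->|_].
  have [dltM|Mled] := ltP d M.
    by rewrite !nov_pow_lt0 ?mulr0 // subr_lt0.
  have -> : d = M by apply/le_anti/andP.
  rewrite subrr IH ?(ltW M0) //.
  have -> : nov_pow a n.+1 0 = 0.
    rewrite nov_powS; apply: fsbig1 => g _.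
    have [/a0 ->|g0] := leP g 0; first by rewrite mul0r.
    by rewrite nov_pow_lt0 ?mulr0 // sub0r oppr_lt0.
  by rewrite lt_eqF //= addr0 !mulr0.
rewrite addr0 IH; last by lra.
by rewrite (_ : d - f == M = false) ?addr0 // lt_eqF //; lra.
Qed.

Lemma fsum_add_single (V : zmodType) (F : nat -> V) (k : nat) (c : V) :
    (exists m, forall n, (m <= n)%N -> F n = 0) ->
  \sum_(n \in [set: nat]) (F n + (if n == k then c else 0))
  = \sum_(n \in [set: nat]) F n + c.
Proof.
move=> [m F0]; set r := iota 0 (maxn m k.+1).
have rP (G : nat -> V) : (forall n, (m <= n)%N -> n != k -> G n = 0) ->
    \sum_(n \in [set: nat]) G n = \sum_(n <- r) G n.
  move=> G0; rewrite (fsbigE r) //.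
  - by rewrite big_mkcond; apply: eq_bigr => n _; rewrite in_setT.
  - exact: iota_uniq.
  move=> n _; rewrite mem_iota /= add0n -leqNgt geq_max => /andP[mn kn].
  by apply: G0; rewrite // neq_ltn kn orbT.
rewrite !rP => [|n mn _|n mn /negPf ->]; rewrite ?F0 ?addr0 //.
rewrite big_split /=; congr (_ + _).
rewrite (bigD1_seq k) ?iota_uniq //= ?eqxx.
  by rewrite big1 ?addr0 // => n /negPf ->.
by rewrite mem_iota /= add0n leq_max leqnn orbT.
Qed.

(** The exponential is its own derivative: up to the exponent M of the
    increment, only the linear term of the exponential series feels it. *)
Lemma nov_exp_perturb a (c : R[i]) M d : Lambda0 a -> 0 < M -> d <= M ->
  nov_exp (fun d => a d + (if d == M then c else 0)) d
  = nov_exp a d + (if d == M then complex_exp (a 0) * c else 0).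
Proof.
move=> La M0 dM; rewrite /nov_exp (lt_eqF M0) addr0.
set p := fun d => if d == 0 then 0 else a d.
set p' := fun d => if d == 0 then 0 else _.
have p0 f : f <= 0 -> p f = 0.
  by rewrite /p le_eqVlt; case: eqP => //= _; apply: Lambda0_lt0.
have -> : p' = fun d => p d + (if d == M then c else 0).
  apply/funext => f; rewrite /p' /p; case: eqP => // ->.
  by rewrite lt_eqF // addr0.
under eq_fsbigr do rewrite nov_pow_perturb //.
have [e e0 gap] := Lambda0_gap La.
have plow f : f < e -> p f = 0.
  move=> fe; have [/p0 //|f0] := leP f 0.
  by rewrite /p gt_eqF // gap // f0.
(* The sums over nat in the definition of the exponential are 0 unless their
   support is finite, so finiteness is needed to split them. *)
have fin : exists m, forall n, (m <= n)%N ->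
    (n`!%:R)^-1 * nov_pow p n d = 0 :> R[i].
  exists (Num.truncn (d / e)).+1 => n mn.
  rewrite (@nov_pow_low _ e) ?mulr0 // -ltr_pdivrMr //.
  by rewrite (lt_le_trans (Num.Theory.truncnS_gt _)) // ler_nat.
case: (eqVneq d M) => [defd|ne] /=; last first.
  by rewrite addr0; congr (_ * _); apply: eq_fsbigr => n _; rewrite addr0.
rewrite -mulrDr -(fsum_add_single 1 c fin); congr (_ * _).
apply: eq_fsbigr => n _; rewrite mulrDr; congr (_ + _).
by case: eqP => [->|_]; rewrite ?mulr0 // fact0 || rewrite /= ?invr1 ?mul1r.
Qed.

Lemma complex_exp_neq0 (z : R[i]) : complex_exp z != 0.
Proof.
apply/eqP => /(congr1 (fun w => (complex.Re w, complex.Im w))) /= [].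
move/eqP; rewrite mulf_eq0 gt_eqF ?expR_gt0 //= => /eqP c0.
move/eqP; rewrite mulf_eq0 gt_eqF ?expR_gt0 //= => /eqP s0.
have := cos2Dsin2 (complex.Im z); rewrite c0 s0 expr0n addr0 => /eqP.
by rewrite eq_sym oner_eq0.
Qed.

End Novikov.

(** * Trivial qW invariants *)

Section TrivialInvariants.
Variable R : realType.

Lemma Lambda0_pairing (eta : 'rV[int]_2) (beta : 'I_2 -> qseries R) :
  (forall j, Lambda0 (beta j)) -> Lambda0 (nov_pairing eta beta).
Proof.
move=> Lb; split=> [E|]; last first.
  apply/nu_geP => d d0; apply: big1 => j _.
  by rewrite (Lambda0_lt0 (Lb j) d0) mul0rz.
apply: (@sub_finite_set _ _
    (\bigcup_(j in [set: 'I_2]) [set d | d <= E /\ beta j d != 0])).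
  move=> d [dE pd]; have [j bj0] : exists j, beta j d != 0.
    apply/existsP; apply: contra_neqT pd => /existsPn b0.
    by apply: big1 => j _; rewrite (eqP (negbNE (b0 j))) mul0rz.
  by exists j.
by apply: bigcup_finite => // j _; case: (Lb j).
Qed.

Lemma Lambda0_add (a b : qseries R) :
  Lambda0 a -> Lambda0 b -> Lambda0 (nov_add a b).
Proof.
move=> La Lb; split=> [E|]; last first.
  by apply/nu_geP => d d0; rewrite /nov_add !Lambda0_lt0 ?addr0.
have [[/(_ E) fa _] [/(_ E) fb _]] := (La, Lb).
have fab := conj fa fb; rewrite -finite_setU in fab.
apply: sub_finite_set fab => d [dE].
have [a0|a0 _] := eqVneq (a d) 0; last by left.
by rewrite /nov_add a0 add0r => b0; right.
Qed.

(** If a facet is strictly nearer to u than any other integral half plane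
    containing D, then perturbing beta by q^M in a direction not parallel to
    the facet changes the potential by a nonzero multiple of q^(M + L), where L
    is the distance from u to the facet, plus terms of higher exponent. A
    critical point would only allow changes of exponent at least M + L + 1. *)
Lemma trivial_qW_unique_nearest (D : set 'rV[R]_2) (u : 'rV[R]_2)
    (e : 'rV[int]_2) (k : R) :
    is_facet D e k ->
    (forall eta kappa, eta != 0 -> (forall x, D x -> 0 <= ell eta kappa x) ->
      eta = e /\ kappa = k \/ ell e k u < ell eta kappa u) ->
  trivial_qW D u.
Proof.
move=> De nearest [N [eta [kappa [alpha [beta [[defD once _] La [Lb crit]]]]]]].
have [i0 [[ei0 ki0] i0_uniq]] := once e k De.
have [j ej0] : exists j, e ord0 j != 0.
  apply/existsP; apply/negbNE/existsPn => e0; case: De => + _ _.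
  by rewrite /primitive !(eqP (negbNE (e0 _))).
set L := ell e k u in nearest.
pose a i := nov_add (nov_pairing (eta i) beta) (alpha i).
have La' i : Lambda0 (a i) by apply: Lambda0_add => //; apply: Lambda0_pairing.
have [M0 /(_ (nov_q (Num.max M0 1)))] := crit j (L + 1).
set M := Num.max M0 1; have M_gt0 : 0 < M by rewrite lt_max ltr01 orbT.
have M0M : (M0%:E <= nu (nov_q M))%E by rewrite nu_q lee_fin le_max lexx.
move=> /(_ (Lambda0_q (ltW M_gt0)) M0M).
move=> /=; set beta_h := fun k => _; set delta := nov_sub _ _.
have a_h i : nov_add (nov_pairing (eta i) beta_h) (alpha i)
    = fun d => a i d + (if d == M then (eta i ord0 j)%:~R else 0).
  apply/funext => d; rewrite /a /nov_add addrAC; congr (_ + _).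
  rewrite /nov_pairing [LHS](bigD1 j) //= [in RHS](bigD1 j) //=.
  rewrite {1}/beta_h eqxx /nov_add mulrzDl addrAC; congr (_ + _).
    congr (_ + _); last by rewrite /nov_q; case: eqP; rewrite ?mul0rz.
  by apply: eq_bigr => l /negPf nlj; rewrite /beta_h nlj.
(* Only the term of the facet e contributes in degree M + L: the others are
   constant in beta, or their exponents start above L. *)
have : delta (M + L) != 0.
  rewrite /delta /nov_sub nov_mul_const0 subr0 /potential -sumrB.
  rewrite (bigD1 i0) //= big1 => [|i ne].
    rewrite !nov_mul_q a_h -/(a i0) ei0 ki0 -/L addrK.
    rewrite addr0 nov_exp_perturb // eqxx addrAC subrr add0r.
    by rewrite mulf_neq0 ?complex_exp_neq0 ?intr_eq0.
  have [eta0|eta_n0] := eqVneq (eta i) 0.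
    have a_hi : nov_add (nov_pairing (eta i) beta_h) (alpha i) = a i.
      by rewrite a_h; apply/funext => d; rewrite eta0 mxE if_same addr0.
    by rewrite a_hi subrr.
  rewrite !nov_mul_q a_h -/(a i).
  have pos x : D x -> 0 <= ell (eta i) (kappa i) x by rewrite defD => /(_ i).
  case: (nearest _ _ eta_n0 pos) => [[ei ki]|lt_Li].
    by rewrite (i0_uniq i) ?eqxx in ne.
  rewrite nov_exp_perturb //; last by lra.
  by rewrite lt_eqF ?addr0 ?subrr //; lra.
move=> /nu_le le_nu; rewrite nu_q => /le_trans/(_ le_nu).
by rewrite -EFinD lee_fin; lra.
Qed.

End TrivialInvariants.

Local Notation cx p := (p ord0 ord0).
Local Notation cy p := (p ord0 ord_max).

(** * Edges of an intersection of half planes *)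

Section HalfPlanes.
Variable R : realType.
Implicit Types (x y z o b w : 'rV[R]_2) (e : 'rV[int]_2) (k t : R).
Implicit Type L : seq ('rV[int]_2 * R).

Lemma row2P (T : Type) (x y : 'rV[T]_2) : cx x = cx y -> cy x = cy y -> x = y.
Proof.
move=> ex ey; apply/rowP => i; have [->|] := eqVneq i ord0; first exact: ex.
case: i => [[|[|]]] // lt1 _.
by rewrite (_ : Ordinal lt1 = ord_max) //; apply: val_inj.
Qed.

Lemma pairingE e x : pairing e x = (cx e)%:~R * cx x + (cy e)%:~R * cy x.
Proof.
rewrite /pairing big_ord_recl big_ord1; congr (_ + _ * _); last congr (x _ _).
  by congr ((e _ _)%:~R); apply: val_inj.
exact: val_inj.
Qed.

Lemma ellE e k x : ell e k x = (cx e)%:~R * cx x + (cy e)%:~R * cy x + k.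
Proof. by rewrite /ell pairingE. Qed.

Lemma ivecE (p q : int) : (cx (ivec p q) = p) * (cy (ivec p q) = q).
Proof. by rewrite !mxE. Qed.

Lemma pairing_line e b w t :
  pairing e (b + t *: w) = pairing e b + t * pairing e w.
Proof. by rewrite !pairingE !mxE; ring. Qed.

Lemma ell_line e k b w t : ell e k (b + t *: w) = ell e k b + t * pairing e w.
Proof. by rewrite /ell pairing_line; ring. Qed.

Lemma ell_mid e k x y : ell e k (2^-1 *: (x + y)) = (ell e k x + ell e k y) / 2.
Proof. by rewrite !ellE !mxE; field. Qed.

Lemma primitive_parallel (e f : 'rV[int]_2) :
  primitive e -> primitive f -> cx e * cy f = cy e * cx f -> e = f \/ e = - f.
Proof.
rewrite /primitive => pe pf det0.
have [u [v uv]] := Bezoutz (cx f) (cy f); rewrite (eqP pf) in uv.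
pose m := u * cx e + v * cy e.
have mx : cx e = m * cx f.
  transitivity (cx e * (u * cx f + v * cy f) - v * (cx e * cy f - cy e * cx f)).
    by rewrite uv det0 subrr mulr0 subr0 mulr1.
  by rewrite /m; ring.
have my : cy e = m * cy f.
  transitivity (cy e * (u * cx f + v * cy f) + u * (cx e * cy f - cy e * cx f)).
    by rewrite uv det0 subrr mulr0 addr0 mulr1.
  by rewrite /m; ring.
have : (m %| gcdz (cx e) (cy e))%Z by rewrite dvdz_gcd mx my !dvdz_mulr.
move/eqP: pe => ->; rewrite dvdz1 => m1.
have [m_eq|m_eq] : m = 1 \/ m = -1 by lia.
  by left; apply: row2P; rewrite ?mx ?my m_eq mul1r.
by right; apply: row2P; rewrite mxE ?mx ?my m_eq mulN1r.
Qed.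

Definition half_planes L : set 'rV[R]_2 :=
  [set x | forall f, f \in L -> 0 <= ell f.1 f.2 x].

(** Two points of an edge have a midpoint at which some half plane of the list
    is active, for otherwise one could leave the edge on the wrong side; that
    half plane is then active along the whole edge. *)
Lemma facet_half_planes L o e k :
    (forall f, f \in L -> primitive f.1) ->
    (forall f, f \in L -> 0 < ell f.1 f.2 o) ->
  is_facet (half_planes L) e k -> (e, k) \in L.
Proof.
move=> prim int_o [pe pos [x [y [[Dx /= ex] [Dy /= ey] nxy]]]].
pose z := 2^-1 *: (x + y).
have ez : ell e k z = 0 by rewrite ell_mid ex ey addr0 mul0r.
have Dz : half_planes L z.
  by move=> f fL; rewrite ell_mid divr_ge0 // addr_ge0 ?Dx ?Dy.
have o_in : half_planes L o by move=> f fL; rewrite ltW // int_o.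
have [f fL fz] : exists2 f, f \in L & ell f.1 f.2 z = 0.
  apply: contrapT => nf.
  pose w := to_plane R e.
  have pos_z f : f \in L -> 0 < ell f.1 f.2 z / (1 + `|pairing f.1 w|).
    move=> fL; apply: divr_gt0; last by rewrite ltr_wpDr.
    by rewrite lt_neqAle Dz // andbT eq_sym; apply/eqP => fz; apply: nf; exists f.
  have [s s0 les] := positive_lower_bound pos_z.
  have /pos : half_planes L (z + (- s) *: w).
    move=> f /les; rewrite ell_line ler_pdivlMr ?ltr_wpDr // mulNr subr_ge0.
    by apply: le_trans; rewrite ler_pM2l // (le_trans (ler_norm _)) // lerDr.
  have : 0 < s * pairing e w.
    rewrite mulr_gt0 // pairingE !mxE -!expr2 lt_neqAle addr_ge0 ?sqr_ge0 //.
    rewrite andbT eq_sym paddr_eq0 ?sqr_ge0 // !sqrf_eq0 !intr_eq0.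
    by apply: contraTN pe => /andP[/eqP ex0 /eqP ey0]; rewrite /primitive ex0 ey0.
  by rewrite ell_line ez; lra.
have [fx fy] : ell f.1 f.2 x = 0 /\ ell f.1 f.2 y = 0.
  by move: (Dx f fL) (Dy f fL) fz; rewrite ell_mid; lra.
(* Both conormals annihilate x - y, which is not zero. *)
have det0 : cx e * cy f.1 = cy e * cx f.1.
  apply/eqP; rewrite -(eqr_int R) !rmorphM /= -subr_eq0.
  set E1 := _%:~R; set F2 := _%:~R; set E2 := _%:~R; set F1 := _%:~R.
  have Ed : E1 * (cx x - cx y) + E2 * (cy x - cy y) = 0.
    by move: ex ey; rewrite !ellE -/E1 -/E2; lra.
  have Fd : F1 * (cx x - cx y) + F2 * (cy x - cy y) = 0.
    by move: fx fy; rewrite !ellE -/F1 -/F2; lra.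
  have [ecx|nx] := eqVneq (cx x) (cx y).
    have [ecy|ny] := eqVneq (cy x) (cy y); first by case: nxy; apply: row2P.
    rewrite -subr_eq0 in ny; apply/eqP/(mulIf ny).
    transitivity (E1 * (F1 * (cx x - cx y) + F2 * (cy x - cy y))
       - F1 * (E1 * (cx x - cx y) + E2 * (cy x - cy y))); first by ring.
    by rewrite Ed Fd; ring.
  rewrite -subr_eq0 in nx; apply/eqP/(mulIf nx).
  transitivity (F2 * (E1 * (cx x - cx y) + E2 * (cy x - cy y))
     - E2 * (F1 * (cx x - cx y) + F2 * (cy x - cy y))); first by ring.
  by rewrite Ed Fd; ring.
have [ef|ef] := primitive_parallel pe (prim f fL) det0.
  suff -> : (e, k) = f by [].
  rewrite [f]surjective_pairing ef; congr pair; move: ex fx.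
  by rewrite !ellE ef; lra.
move: (int_o f fL) (pos o o_in) ex fx.
by rewrite !ellE ef !mxE !rmorphN; lra.
Qed.

(** There are at most as many edges as half planes in the list, so if the
    count is exact none of the half planes can be redundant. *)
Lemma all_facets_half_planes L o f :
    (forall f, f \in L -> primitive f.1) ->
    (forall f, f \in L -> 0 < ell f.1 f.2 o) ->
    (edges (half_planes L) #= `I_(size L))%card ->
  f \in L -> is_facet (half_planes L) f.1 f.2.
Proof.
move=> prim int_o card_edges fL; apply: contrapT => nf.
pose F i := let g := nth f (rem f L) i in facet_set (half_planes L) g.1 g.2.
have sub : edges (half_planes L) `<=` F @` `I_(size L).-1.
  move=> _ [e [k [De ->]]].
  have ekL := facet_half_planes prim int_o De.
  have ek_rem : (e, k) \in rem f L.
    move: ekL; rewrite (perm_mem (perm_to_rem fL)) inE => /predU1P[ekf|//].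
    by case: nf; rewrite -ekf.
  exists (index (e, k) (rem f L)) => /=.
    by rewrite -(size_rem fL) index_mem.
  by rewrite /F nth_index.
have := card_le_trans (subset_card_le sub) (card_image_le _ _).
rewrite (card_le_eql card_edges) card_le_II.
by case: L fL {prim int_o card_edges nf F sub} => //= g L _; rewrite ltnn.
Qed.

End HalfPlanes.

(** * Probes, reflections and flags *)

Section Probes.
Variable R : realType.
Implicit Types (x y z b w u : 'rV[R]_2) (e v : 'rV[int]_2) (k t s l : R).
Implicit Types (P Q : probe R) (D : set 'rV[R]_2).

(** This makes the affine distance well defined: two primitive vectors on one
    line differ by a factor that is an integer in both directions. *)
Lemma primitive_scale v v' s s' :
    primitive v' -> s *: to_plane R v = s' *: to_plane R v' ->
  exists p : int, s' = s * p%:~R.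
Proof.
move=> pv' eq_sv; have [m [n mn]] := Bezoutz (cx v') (cy v').
have ex : s * (cx v)%:~R = s' * (cx v')%:~R.
  by move/(congr1 (fun p : 'rV[R]_2 => cx p)): eq_sv; rewrite !mxE.
have ey : s * (cy v)%:~R = s' * (cy v')%:~R.
  by move/(congr1 (fun p : 'rV[R]_2 => cy p)): eq_sv; rewrite !mxE.
move/eqP: pv' => pv'; rewrite pv' in mn.
exists (m * cx v + n * cy v); rewrite rmorphD !rmorphM /=.
transitivity (s' * (m * cx v' + n * cy v')%:~R); first by rewrite mn mulr1.
rewrite rmorphD !rmorphM /=.
transitivity (m%:~R * (s' * (cx v')%:~R) + n%:~R * (s' * (cy v')%:~R)).
  by ring.
by rewrite -ex -ey; ring.
Qed.

Lemma daffE x y v s :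
  primitive v -> x - y = s *: to_plane R v -> daff x y = `|s|.
Proof.
move=> pv xy; rewrite /daff; apply: xget_unique; first by exists v, s.
move=> _ [v' [s' [pv' + ->]]]; rewrite xy => eq_sv.
have [p sp] := primitive_scale pv' eq_sv.
have [q] := primitive_scale pv (esym eq_sv).
rewrite {}sp normrM; have [->|s0] := eqVneq s 0; first by rewrite normr0 !mul0r.
rewrite -mulrA -{1}[s]mulr1 => /(mulfI s0)/eqP.
rewrite -rmorphM /= -(rmorph1 intr) eqr_int => /eqP pq.
suff -> : `|p%:~R| = 1 :> R by rewrite mulr1.
have : (p %| p * q)%Z by apply: dvdz_mulr.
rewrite -pq dvdz1 => p1; have [->|->] : p = 1 \/ p = -1 by lia.
  by rewrite normr1.
by rewrite rmorphN normrN normr1.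
Qed.

Lemma ell_segment v b e k t :
    pairing e (to_plane R v) = 1 -> ell e k b = 0 ->
  ell e k (b + t *: to_plane R v) = t.
Proof. by rewrite ell_line => -> ->; rewrite add0r mulr1. Qed.

Lemma ell_facet_interior D e k x : facet_interior D e k x -> ell e k x = 0.
Proof.
move=> [y [z [[_ ey] [_ ez] _ [s _ ->]]]].
transitivity ((1 - s) * ell e k y + s * ell e k z).
  by rewrite !ellE !mxE; ring.
by rewrite ey ez !mulr0 addr0.
Qed.

Lemma probeP D P : is_probe D P ->
  [/\ is_facet D (pnormal P) (pconst P), D (pbase P),
      ell (pnormal P) (pconst P) (pbase P) = 0,
      pairing (pnormal P) (pvec P) = 1
    & 0 < plen P /\ forall t, 0 <= t <= plen P -> D (pbase P + t *: pvec P)].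
Proof.
move=> [facetP /ell_facet_interior eb [_ vP1] [len0 subD]].
have Dt t : 0 <= t <= plen P -> D (pbase P + t *: pvec P).
  by move=> t_int; apply: subD; exists t.
split=> //; have := Dt 0; rewrite scale0r addr0; apply.
by rewrite lexx ltW.
Qed.

Lemma daff_facet_probe D P t : is_probe D P -> 0 <= t ->
  daff_facet (pbase P + t *: pvec P) (pnormal P) (pconst P) = t.
Proof.
by move=> /probeP[_ _ eb vP1 _] t0; rewrite /daff_facet ell_segment ?ger0_norm.
Qed.

Lemma conv_hull_vertex n (p : 'I_n -> 'rV[R]_2) i : conv_hull p (p i).
Proof.
exists (fun j => (j == i)%:R); split=> [j||]; first exact: ler0n.
  by rewrite (bigD1 i) //= eqxx big1 ?addr0 // => j /negPf ->.
rewrite (bigD1 i) //= eqxx scale1r big1 ?addr0 // => j /negPf ->.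
by rewrite scale0r.
Qed.

Lemma reflE Q e' k' x : refl Q e' k' x
  = x + (ell e' k' x - ell (pnormal Q) (pconst Q) x) *: pvec Q.
Proof.
rewrite /refl /refl_lin -addrA -scalerDl; congr (_ + _ *: _).
by rewrite !ellE pairingE !mxE !rmorphB /=; ring.
Qed.

Lemma refl_line Q e' k' x w t :
  refl Q e' k' (x + t *: w) = refl Q e' k' x + t *: refl_lin Q e' w.
Proof.
rewrite !reflE /refl_lin !ell_line scalerDr scalerA addrACA -scalerDl.
by congr (_ + _ *: _); rewrite !pairingE !mxE !rmorphB /=; ring.
Qed.

(** Along a symmetric probe the distances to its two end facets add up to its
    length, so the reflection reverses it. *)
Lemma refl_symmetric_probe D Q e' k' t : is_symmetric_probe D Q e' k' ->
  refl Q e' k' (pbase Q + t *: pvec Q) = pbase Q + (plen Q - t) *: pvec Q.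
Proof.
move=> [/probeP[_ _ eb vQ1 _] _ /ell_facet_interior ee vQ'].
rewrite /pend ell_line vQ' in ee.
rewrite reflE (ell_line e') vQ' (ell_segment _ vQ1 eb) -addrA -scalerDl.
by congr (_ + _ *: _); lra.
Qed.

(** The first claim holds because l is less than the length at which the
    continuation of P would hit the line of the facet of Q. For the second, the
    tip of the continuation differs from the far corner x' + l w' of the flag
    by a multiple of the direction of Q. The corner x + l w lies on the inner
    side of the facet, which bounds the shear l mu c from above, and the width
    of the flag exceeds the distance d of the end of P from the facet;
    together they make the multiple positive. *)
Lemma flag_tip D P Q (mu : R) x x' l :
    let c := pairing (pnormal Q) (pvec P) in
    let w := pvec P - ((1 + mu) * c) *: pvec Q in
    let w' := pvec P - (mu * c) *: pvec Q in
    is_probe D Q -> probe_set Q (pend P) -> 0 <= mu -> 0 <= l ->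
    probe_set Q x -> probe_set Q x' ->
    daff (pbase Q) x < daff (pbase Q) x' ->
    conv_hull (tnth [tuple x; x'; x + l *: w; x' + l *: w']) `<=` D ->
    daff_facet (pend P) (pnormal Q) (pconst Q) < daff x x' ->
    (l%:E < ddir_facet (pdir P) (pend P) (pnormal Q) (pconst Q))%E ->
  0 < ell (pnormal Q) (pconst Q) (pend P + l *: pvec P) /\
  exists2 rho, 0 < rho & D (pend P + l *: pvec P + rho *: pvec Q).
Proof.
move=> c w w' Qprobe [d /andP[d0 _] defE] mu0 l0 [s /andP[s0 _] ->].
move=> [s' /andP[s'0 _] ->] closer hullD wide short.
have [[_ posQ _] _ [prQ _] _] := Qprobe.
have [_ _ ebQ vQ1 _] := probeP Qprobe.
have daff_base r : 0 <= r -> daff (pbase Q) (pbase Q + r *: pvec Q) = r.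
  move=> r0; rewrite (@daffE _ _ (pdir Q) (- r)) ?normrN ?ger0_norm //.
  by rewrite opprD addNKr scaleNr.
rewrite !daff_base // in closer.
have {}wide : d < s' - s.
  move: wide; rewrite defE (daff_facet_probe Qprobe d0).
  rewrite (@daffE _ _ (pdir Q) (s - s')) //.
    by rewrite distrC gtr0_norm ?subr_gt0.
  by rewrite opprD addrACA subrr add0r -scalerBl.
have ellE_ t : ell (pnormal Q) (pconst Q) (pend P + t *: pvec P) = d + t * c.
  by rewrite ell_line defE ell_segment.
split.
  rewrite ellE_ ltNge; apply/negP => far.
  suff [t /andP[t0 tl] hit] : exists2 t, 0 <= t <= l & d + t * c = 0.
    move: short; rewrite ltNge; apply/negP; rewrite negbK.
    apply: (@le_trans _ _ t%:E); last by rewrite lee_fin.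
    by apply: ereal_inf_lbound; exists t => //; split=> //; rewrite ellE_.
  have [c0|c0] := ltP c 0; last first.
    have lc0 : 0 <= l * c by rewrite mulr_ge0.
    by exists 0; rewrite ?lexx ?l0 //; lra.
  have nc0 : 0 < - c by rewrite oppr_gt0.
  exists (d / - c); last by rewrite invrN mulrN mulNr divfK ?subrr // lt_eqF.
  by rewrite divr_ge0 ?(ltW nc0) //= ler_pdivrMr //; lra.
have Dx : D (pbase Q + s *: pvec Q + l *: w).
  by apply: hullD; apply: (conv_hull_vertex _ (Ordinal (isT : 2 < 4)%N)).
have Dx' : D (pbase Q + s' *: pvec Q + l *: w').
  by apply: hullD; apply: (conv_hull_vertex _ (Ordinal (isT : 3 < 4)%N)).
have r0 : 0 <= s - l * (mu * c).
  have := posQ _ Dx; rewrite ell_line ell_segment //.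
  suff -> : pairing (pnormal Q) w = - (mu * c) by rewrite mulrN.
  by rewrite /w -scaleNr pairing_line vQ1 -/c; ring.
exists (s' - d - l * (mu * c)); first by lra.
suff -> : pend P + l *: pvec P + (s' - d - l * (mu * c)) *: pvec Q
  = pbase Q + s' *: pvec Q + l *: w' by [].
by rewrite defE /w'; apply: row2P; rewrite !mxE; ring.
Qed.

End Probes.

(** * The polygon *)

Section Polygon.
Variables (R : realType) (eps k4 k5 k6 k7 k8 : R).
Hypothesis eps_gt0 : 0 < eps.
(* Probes close to the corner (0, 8) set the scale: they are controlled up to
   8 * 41 * eps, which has to be well below 1. *)
Hypothesis eps_small : 40 * (50 * eps) <= 1.
Hypothesis k4_near : 8 - eps < k4 < 8.
Hypothesis k5_near : 16 - eps < k5 < 16.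
Hypothesis k6_near : 25 - eps < k6 < 25.
Hypothesis k7_near : 10 - eps < k7 < 10.
Hypothesis k8_near : 5 - eps < k8 < 5.
Implicit Types (x y z b w u : 'rV[R]_2) (e v : 'rV[int]_2) (k t s l : R).

Let D := Delta_bar k4 k5 k6 k7 k8.

Let eps_bounds : 0 < eps /\ 40 * (50 * eps) <= 1. Proof. by []. Qed.
Let kappas_near : [/\ 8 - eps < k4 < 8, 16 - eps < k5 < 16,
  25 - eps < k6 < 25, 10 - eps < k7 < 10 & 5 - eps < k8 < 5].
Proof. by split. Qed.

(** The facets are referred to by their position in this list, from 1. *)
Definition facet_list : seq ('rV[int]_2 * R) :=
  [:: (ivec 1 0, 0); (ivec 0 1, 0); (ivec (-8) (-5), 40); (ivec (-1) (-1), k4);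
      (ivec (-3) (-2), k5); (ivec (-5) (-3), k6); (ivec (-2) (-1), k7);
      (ivec (-1) 0, k8)].

Lemma ell_ivec (p q : int) k x :
  ell (ivec p q) k x = p%:~R * cx x + q%:~R * cy x + k.
Proof. by rewrite ellE !ivecE. Qed.

Lemma DeltaP x : D x <->
  [/\ 0 <= cx x, 0 <= cy x, 8 * cx x + 5 * cy x <= 40, cx x + cy x <= k4
    & 3 * cx x + 2 * cy x <= k5] /\
  [/\ 5 * cx x + 3 * cy x <= k6, 2 * cx x + cy x <= k7 & cx x <= k8].
Proof.
rewrite /D /Delta_bar /= !ell_ivec.
split=> [[[? ? ?] [? ? ? ? ?]]|[[? ? ? ? ?] [? ? ?]]]; split; split; lra.
Qed.

Lemma Delta_half_planes : D = half_planes facet_list.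
Proof.
apply/seteqP; split=> x; rewrite DeltaP.
  move=> [[? ? ? ? ?] [? ? ?]] f; rewrite !inE.
  by do 7?[case/orP]; move/eqP->; rewrite /= ell_ivec; lra.
move=> Hx; have {}Hx f : f \in facet_list -> 0 <= ell f.1 f.2 x by apply: Hx.
have h1 := Hx (ivec 1 0, 0); have h2 := Hx (ivec 0 1, 0).
have h3 := Hx (ivec (-8) (-5), 40); have h4 := Hx (ivec (-1) (-1), k4).
have h5 := Hx (ivec (-3) (-2), k5); have h6 := Hx (ivec (-5) (-3), k6).
have h7 := Hx (ivec (-2) (-1), k7); have h8 := Hx (ivec (-1) 0, k8).
move: h1 h2 h3 h4 h5 h6 h7 h8; rewrite !inE !eqxx !orbT !ell_ivec /=.
do 8!move=> /(_ isT) ?.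
by split; split; lra.
Qed.

Lemma facet_list_primitive f : f \in facet_list -> primitive f.1.
Proof.
by rewrite !inE; do 7?[case/orP]; move/eqP->; rewrite /primitive !ivecE.
Qed.

Definition point (p q : R) : 'rV[R]_2 := \row_j (if j == ord0 then p else q).

Lemma pointE (p q : R) : (cx (point p q) = p) * (cy (point p q) = q).
Proof. by rewrite !mxE. Qed.

Lemma facet_list_centre f :
  f \in facet_list -> 0 < ell f.1 f.2 (point (23 / 10) (19 / 5)).
Proof.
have [? ? ? ? ?] := kappas_near; have [? ?] := eps_bounds.
by rewrite !inE; do 7?[case/orP]; move/eqP->; rewrite /= ell_ivec !pointE; lra.
Qed.

Variant facet_spec : 'rV[int]_2 -> R -> Prop :=
| Facet1 : facet_spec (ivec 1 0) 0
| Facet2 : facet_spec (ivec 0 1) 0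
| Facet3 : facet_spec (ivec (-8) (-5)) 40
| Facet4 : facet_spec (ivec (-1) (-1)) k4
| Facet5 : facet_spec (ivec (-3) (-2)) k5
| Facet6 : facet_spec (ivec (-5) (-3)) k6
| Facet7 : facet_spec (ivec (-2) (-1)) k7
| Facet8 : facet_spec (ivec (-1) 0) k8.

Lemma facetP e k : is_facet D e k -> facet_spec e k.
Proof.
rewrite Delta_half_planes => De.
have := facet_half_planes facet_list_primitive facet_list_centre De.
by rewrite !inE; do 7?[case/orP]; move/eqP => [-> ->]; constructor.
Qed.

Lemma facet5 :
  (edges D #= `I_8)%card -> is_facet D (ivec (-3) (-2)) k5.
Proof.
rewrite Delta_half_planes => card8.
apply: (all_facets_half_planes (f := (ivec (-3) (-2), k5))
  facet_list_primitive facet_list_centre card8).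
by rewrite !inE eqxx !orbT.
Qed.

Definition near_centre u :=
  23 / 10 - eps < cx u < 23 / 10 + eps /\
  19 / 5 - eps < cy u < 19 / 5 + eps.

(** The value at u is a convex combination, with weights about 13/200, 23/50
    and 19/40, of the values at three points next to the corners. As these
    values are nonnegative, a bound on the value at u bounds each of them, and
    then p and q. *)
Lemma small_covector (p q : int) k u : near_centre u ->
    0 <= k -> 0 <= p%:~R * (5 - 100^-1) + k -> 0 <= q%:~R * (8 - 100^-1) + k ->
    p%:~R * cx u + q%:~R * cy u + k < 31 / 20 ->
  (p = 0 /\ q = 0) \/ (p = -3 /\ q = -2).
Proof.
move=> [ux uy]; move: (cx u) (cy u) ux uy => X Y ux uy kO kA kB small.
have {}ux : 23 / 10 - 200^-1 < X < 23 / 10 + 200^-1.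
  by have [_ ?] := eps_bounds; lra.
have {}uy : 19 / 5 - 200^-1 < Y < 19 / 5 + 200^-1.
  by have [_ ?] := eps_bounds; lra.
have pX : (0 <= p%:~R :> R /\ p%:~R * (23 / 10 - 200^-1) <= p%:~R * X) \/
    (p%:~R <= 0 :> R /\ p%:~R * (23 / 10 + 200^-1) <= p%:~R * X).
  by have [p0|/ltW p0] := leP 0 (p%:~R : R); [left|right]; split=> //; nra.
have qY : (0 <= q%:~R :> R /\ q%:~R * (19 / 5 - 200^-1) <= q%:~R * Y) \/
    (q%:~R <= 0 :> R /\ q%:~R * (19 / 5 + 200^-1) <= q%:~R * Y).
  by have [q0|/ltW q0] := leP 0 (q%:~R : R); [left|right]; split=> //; nra.
have [[p_gt p_lt] [q_gt q_lt]] : ((-6)%:~R < p%:~R :> R /\ p%:~R < 1%:~R :> R)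
    /\ ((-4)%:~R < q%:~R :> R /\ q%:~R < 1%:~R :> R).
  by clear ux uy; case: pX => -[? ?]; case: qY => -[? ?]; split; split; lra.
rewrite !ltr_int in p_gt p_lt q_gt q_lt.
have {p_gt p_lt} : p \in [:: 0; -1; -2; -3; -4; -5].
  by clear -p_gt p_lt; rewrite !inE; lia.
have {q_gt q_lt} : q \in [:: 0; -1; -2; -3].
  by clear -q_gt q_lt; rewrite !inE; lia.
rewrite !inE => /or4P[] /eqP eq_q; do 5?[case/orP]; move/eqP => eq_p;
  try (by left); try (by right); exfalso; clear pX qY;
  move: kA kB small; rewrite eq_p eq_q; lra.
Qed.

Lemma corner_points : [/\ D (point 0 0), D (point (5 - 100^-1) 0)
  & D (point 0 (8 - 100^-1))].
Proof.
have [? ? ? ? ?] := kappas_near; have [? ?] := eps_bounds.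
by split; apply/DeltaP; rewrite !pointE; split; split; lra.
Qed.

(** The distance from u to the fifth facet is about 3/2. An integral affine
    function that is nonnegative on D and not larger at u must be a translate
    of the one defining that facet, and a point of the facet forbids to lower
    the constant term. *)
Lemma nearest_facet u e k :
    is_facet D (ivec (-3) (-2)) k5 -> near_centre u -> e != 0 ->
    (forall x, D x -> 0 <= ell e k x) ->
  e = ivec (-3) (-2) /\ k = k5 \/ ell (ivec (-3) (-2)) k5 u < ell e k u.
Proof.
move=> [_ _ [x5 [_ [[D5 /= on5] _ _]]]] u_near e0 pos.
have [DO DA DB] := corner_points.
have kO := pos _ DO; have kA := pos _ DA; have kB := pos _ DB.
have k_ge := pos _ D5; move: k_ge on5 kO kA kB.
rewrite !ell_ivec !ellE !pointE !mulr0 !add0r addr0 => k_ge on5 kO kA kB.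
have [_ ? _ _ _] := kappas_near; have [? ?] := eps_bounds.
have [ux uy] := u_near.
have [|far] := ltP ((-3)%:~R * cx u + (-2)%:~R * cy u + k5) (
  (cx e)%:~R * cx u + (cy e)%:~R * cy u + k); first by right.
have [[p0 q0]|[p3 q2]] := small_covector u_near kO kA kB ltac:(lra).
  by case/eqP: e0; apply: row2P; rewrite mxE.
left; split; first by apply: row2P; rewrite ivecE.
move: k_ge far; rewrite p3 q2; lra.
Qed.


(** * Probes through the centre *)

Lemma lt_intr_scale t (p n : int) :
  0 < t -> t * p%:~R < t * n%:~R -> (p < n)%R.
Proof. by move=> t0; rewrite ltr_pM2l // ltr_int. Qed.

Lemma pairing_int e v (n : int) :
  pairing e (to_plane R v) = n%:~R -> cx e * cx v + cy e * cy v = n.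
Proof.
by rewrite pairingE !mxE -!rmorphM -rmorphD /= => /eqP; rewrite eqr_int => /eqP.
Qed.

(** The distance from the centre to a facet is the parameter of the centre on
    any probe from that facet. As the base point has to lie in the polygon,
    this bounds the coordinates of the direction, and only four integral
    directions are left. *)
Lemma probes_through_centre P t :
    is_probe D P -> 0 <= t -> near_centre (pbase P + t *: pvec P) ->
  [/\ pnormal P = ivec 1 0, pconst P = 0, cx (pdir P) = 1
    & cy (pdir P) \in [:: -1; 0; 1]]
  \/ [/\ pnormal P = ivec 0 1, pconst P = 0, cx (pdir P) = 0 & cy (pdir P) = 1].
Proof.
case: P => n c b v L /probeP[] /= /facetP.
rewrite /pvec /= => spec Db eb vP1 _ t0.
have := ell_segment t vP1 eb; move: vP1 => /(pairing_int (n := 1)).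
rewrite /near_centre [in ell _ _ (_ + _)]ellE !mxE.
set p := cx v; set q := cy v; move: eb; rewrite ellE.
move/DeltaP: Db; move: (cx b) (cy b) => x y [[x0 y0 xy3 _ _] _].
have [? ?] := eps_bounds.
case: spec; rewrite !ivecE => eb vP1 et [ux uy].
- have p1 : p = 1 by clear -vP1; lia.
  left; split=> //; rewrite p1 in et ux.
  have t_gt0 : 0 < t by lra.
  have q_gt : (-2 < q)%R by apply: (lt_intr_scale t_gt0); lra.
  have q_lt : (q < 2)%R by apply: (lt_intr_scale t_gt0); lra.
  by clear -q_gt q_lt; rewrite !inE; lia.
- have q1 : q = 1 by clear -vP1; lia.
  right; split=> //; rewrite q1 in et uy.
  have t_gt0 : 0 < t by lra.
  have p_gt : (-1 < p)%R by apply: (lt_intr_scale t_gt0); lra.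
  have p_lt : (p < 1)%R by apply: (lt_intr_scale t_gt0); lra.
  by clear -p_gt p_lt; lia.
- have t_gt0 : 0 < t by lra.
  have p_gt : (-2 < p)%R by apply: (lt_intr_scale t_gt0); lra.
  have p_lt : (p < 1)%R by apply: (lt_intr_scale t_gt0); lra.
  by exfalso; clear -p_gt p_lt vP1; lia.
- have [? _ _ _ _] := kappas_near; have t_gt0 : 0 < t by lra.
  have q_gt : (-3 < q)%R by apply: (lt_intr_scale t_gt0); lra.
  have q_lt : (q < -2)%R by apply: (lt_intr_scale t_gt0); lra.
  by exfalso; clear -q_gt q_lt; lia.
- have [_ ? _ _ _] := kappas_near; have t_gt0 : 0 < t by lra.
  have p_gt : (1 < p)%R by apply: (lt_intr_scale t_gt0); lra.
  have p_lt : (p < 2)%R by apply: (lt_intr_scale t_gt0); lra.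
  by exfalso; clear -p_gt p_lt; lia.
- have [_ _ ? _ _] := kappas_near; have t_gt0 : 0 < t by lra.
  have p_gt : (-2 < p)%R by apply: (lt_intr_scale t_gt0); lra.
  have p_lt : (p < -1)%R by apply: (lt_intr_scale t_gt0); lra.
  by exfalso; clear -p_gt p_lt; lia.
- have [_ _ _ ? _] := kappas_near; have t_gt0 : 0 < t by lra.
  have p_gt : (-2 < p)%R by apply: (lt_intr_scale t_gt0); lra.
  have p_lt : (p < -1)%R by apply: (lt_intr_scale t_gt0); lra.
  by exfalso; clear -p_gt p_lt; lia.
have [_ _ _ _ ?] := kappas_near; have t_gt0 : 0 < t by lra.
have q_gt : (1 < q)%R by apply: (lt_intr_scale t_gt0); lra.
have q_lt : (q < 2)%R by apply: (lt_intr_scale t_gt0); lra.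
by exfalso; clear -q_gt q_lt; lia.
Qed.

(** * Symmetric probes *)

(** The six kinds of symmetric probes away from the corners A = (5, 0) and
    B = (0, 8) are named after the two facets they join. The bounds locate the
    probe, and the formulas for the reflection come from the direction, which
    the equations of the two facets determine up to finitely many integral
    solutions. *)
Variant symmetric_spec (S : set 'rV[R]_2) (A : 'rV[R]_2 -> 'rV[R]_2) : Prop :=
| NearA of forall z, S z -> 24 / 5 <= cx z
| NearB of forall z, S z -> 77 / 10 <= cy z
| Symmetric12 of forall z, S z -> cx z + cy z <= 51 / 10
    & forall x, A x = point (cy x) (cx x)
| Symmetric17 of forall z, S z -> cx z + cy z <= 51 / 10
    & forall x, A x = point (k7 - 2 * cx x - cy x) (3 * cx x + 2 * cy x - k7)
| Symmetric18 of forall z, S z -> cx z + cy z <= 51 / 10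
    & forall x, A x = point (k8 - cx x) (cy x + 2 * cx x - k8)
| Symmetric18_bottom of forall z, S z -> cy z <= 1 / 10
    & forall x, A x = point (k8 - cx x) (cy x)
| Symmetric24 of forall z, S z -> cx z <= 1 / 10
    & forall x, A x = point (cx x) (k4 - cx x - cy x)
| Symmetric56 of forall z, S z -> 399 / 10 <= 8 * cx z + 5 * cy z
    & forall x, A x = point (5 * (k6 - k5) - 9 * cx x - 5 * cy x)
        (16 * cx x + 9 * cy x - 8 * (k6 - k5)).

(** The facets that cut off the corner A, and those with an end close to A;
   likewise for B. *)
Variant cutA : 'rV[int]_2 -> R -> Prop :=
| CutA6 : cutA (ivec (-5) (-3)) k6
| CutA7 : cutA (ivec (-2) (-1)) k7
| CutA8 : cutA (ivec (-1) 0) k8.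

Variant atA : 'rV[int]_2 -> R -> Prop :=
| AtA2 : atA (ivec 0 1) 0
| AtA3 : atA (ivec (-8) (-5)) 40
| AtA_cut e k of cutA e k : atA e k.

Variant cutB : 'rV[int]_2 -> R -> Prop :=
| CutB4 : cutB (ivec (-1) (-1)) k4
| CutB5 : cutB (ivec (-3) (-2)) k5.

Variant atB : 'rV[int]_2 -> R -> Prop :=
| AtB1 : atB (ivec 1 0) 0
| AtB3 : atB (ivec (-8) (-5)) 40
| AtB_cut e k of cutB e k : atB e k.

Lemma cutA_near e k z :
  cutA e k -> D z -> 5 - 5 * (ell e k z + eps) <= cx z.
Proof.
have [? ?] := eps_bounds => cut /DeltaP[[? ? ? _ _] _].
case: cut; rewrite ell_ivec.
- by have [_ _ ? _ _] := kappas_near; lra.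
- by have [_ _ _ ? _] := kappas_near; lra.
by have [_ _ _ _ ?] := kappas_near; lra.
Qed.

Lemma cutB_near e k z :
  cutB e k -> D z -> 8 - 8 * (ell e k z + eps) <= cy z.
Proof.
have [? ?] := eps_bounds => cut /DeltaP[[? ? ? _ _] _].
case: cut; rewrite ell_ivec; first by have [? _ _ _ _] := kappas_near; lra.
by have [_ ? _ _ _] := kappas_near; lra.
Qed.

Lemma atA_small e k z :
  atA e k -> D z -> 5 - 5 * eps <= cx z -> ell e k z <= 40 * eps.
Proof.
have [? _] := eps_bounds => at' /DeltaP[[_ ? ? _ _] _] ?.
case: at' => [||_ _ []]; rewrite ell_ivec; try lra.
- by have [_ _ ? _ _] := kappas_near; lra.
- by have [_ _ _ ? _] := kappas_near; lra.
by have [_ _ _ _ ?] := kappas_near; lra.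
Qed.

Lemma atB_small e k z :
  atB e k -> D z -> 8 - 8 * eps <= cy z -> ell e k z <= 40 * eps.
Proof.
have [? _] := eps_bounds => at' /DeltaP[[? _ ? _ _] _] ?.
case: at' => [||_ _ []]; rewrite ell_ivec; try lra.
  by have [? _ _ _ _] := kappas_near; lra.
by have [_ ? _ _ _] := kappas_near; lra.
Qed.

(** The length of a symmetric probe is the distance of either end to the facet
    at the other end. If one end is on a cut and the other facet ends at the
    same corner, the whole probe is short and so stays close to the cut. *)
Lemma cutA_short e k e' k' y z :
    cutA e k -> atA e' k' -> D y -> ell e k y = 0 -> D z ->
    ell e k z <= ell e' k' y ->
  24 / 5 <= cx z.
Proof.
move=> cut at' Dy y0 Dz zy; have [? ?] := eps_bounds.
have y_near := cutA_near cut Dy; rewrite y0 add0r in y_near.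
have y_small := atA_small at' Dy y_near.
by have z_near := cutA_near cut Dz; lra.
Qed.

Lemma cutB_short e k e' k' y z :
    cutB e k -> atB e' k' -> D y -> ell e k y = 0 -> D z ->
    ell e k z <= ell e' k' y ->
  77 / 10 <= cy z.
Proof.
move=> cut at' Dy y0 Dz zy; have [? ?] := eps_bounds.
have y_near := cutB_near cut Dy; rewrite y0 add0r in y_near.
have y_small := atB_small at' Dy y_near.
by have z_near := cutB_near cut Dz; lra.
Qed.

(** The segment is given by its base b, direction v and length L rather than as a
    probe, and S is kept apart from it, so that the two ends can be exchanged. *)
Lemma symmetric_ends e k e' k' b v L (S : set 'rV[R]_2)
    (A : 'rV[R]_2 -> 'rV[R]_2) :
    facet_spec e k -> facet_spec e' k' ->
    D b -> D (b + L *: to_plane R v) ->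
    ell e k b = 0 -> ell e' k' (b + L *: to_plane R v) = 0 ->
    pairing e (to_plane R v) = 1 -> pairing e' (to_plane R v) = -1 -> 0 < L ->
    (forall z, S z ->
      D z /\ exists2 t, 0 <= t <= L & z = b + t *: to_plane R v) ->
    (forall x, A x = x + (ell e' k' x - ell e k x) *: to_plane R v) ->
  symmetric_spec S A.
Proof.
(* Reversing a symmetric probe exchanges its two facets and leaves the
   reflection as it is, so the facets may be listed in a fixed order; the
   function 10 x + y separates the eight conormals. *)
wlog ord : e k e' k' b v / (10 * cx e' + cy e' <= 10 * cx e + cy e)%R.
  move=> ordered spec spec' Db D_end eb e'L v1 v2 L0 on_S AE.
  have [|/ltW] := leP (10 * cx e' + cy e') (10 * cx e + cy e).
    by move=> ord; apply: (ordered e k e' k' b v ord).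
  have NvE : to_plane R (- v) = - to_plane R v.
    by apply: row2P; rewrite !mxE rmorphN.
  have NtE t : b + L *: to_plane R v + t *: to_plane R (- v)
      = b + (L - t) *: to_plane R v.
    by rewrite NvE scalerN -scaleNr -addrA -scalerDl.
  move=> ord; apply: (ordered e' k' e k (b + L *: to_plane R v) (- v) ord) => //.
  - by rewrite NtE subrr scale0r addr0.
  - by rewrite NtE subrr scale0r addr0.
  - by rewrite NvE -[- _]add0r -scaleN1r pairing_line v2 pairingE !mxE; ring.
  - by rewrite NvE -[- _]add0r -scaleN1r pairing_line v1 pairingE !mxE; ring.
  - move=> z /on_S[Dz [t /andP[t0 tL] defz]]; split=> //.
    exists (L - t); last by rewrite NtE subKr.
    by rewrite subr_ge0 tL gerBl.
  by move=> x; rewrite AE NvE scalerN -scaleNr opprB.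
move=> spec spec' Db D_end eb e'L v1 v2 L0 on_S AE.
have eL := ell_segment L v1 eb.
have e'b : ell e' k' b = L.
  by move: e'L; rewrite ell_line v2 mulrN1 => /eqP; rewrite subr_eq0 => /eqP.
have {}on_S z : S z -> exists t, [/\ 0 <= t <= L, D z, ell e k z = t,
    ell e' k' z = L - t & z = b + t *: to_plane R v].
  move=> /on_S[Dz [t t_int defz]]; exists t; split=> //; rewrite defz.
    exact: ell_segment.
  by rewrite ell_line v2 e'b mulrN1.
have {}v1 := pairing_int (n := 1) v1; have {}v2 := pairing_int (n := -1) v2.
have near1 : cutA e k -> atA e' k' -> symmetric_spec S A.
  move=> cut at'; apply: NearA => z /on_S[t [/andP[t0 tL] Dz ez _ _]].
  by apply: (cutA_short cut at' Db eb Dz); rewrite ez e'b.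
have near2 : atA e k -> cutA e' k' -> symmetric_spec S A.
  move=> at' cut; apply: NearA => z /on_S[t [/andP[t0 tL] Dz _ e'z _]].
  by apply: (cutA_short cut at' D_end e'L Dz); rewrite e'z eL gerBl.
have near3 : cutB e k -> atB e' k' -> symmetric_spec S A.
  move=> cut at'; apply: NearB => z /on_S[t [/andP[t0 tL] Dz ez _ _]].
  by apply: (cutB_short cut at' Db eb Dz); rewrite ez e'b.
have near4 : atB e k -> cutB e' k' -> symmetric_spec S A.
  move=> at' cut; apply: NearB => z /on_S[t [/andP[t0 tL] Dz _ e'z _]].
  by apply: (cutB_short cut at' D_end e'L Dz); rewrite e'z eL gerBl.
have [? ?] := eps_bounds.
move/DeltaP: Db => [[b1 b2 b3 _ _] _].
move/DeltaP: D_end => [[]]; rewrite !mxE => d1 d2 d3 _ _ _.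
(* The pairs of facets close to the same corner A or B, and those for which the
   equations for the direction have no integral solution, are settled here. *)
case: spec ord eb eL v1 AE on_S e'b e'L v2 near1 near2 near3 near4;
  case: spec'; rewrite !ivecE => ord eb eL v1 AE on_S e'b e'L v2
    near1 near2 near3 near4;
  try (by []);
  try (by apply: near1; do ?constructor); try (by apply: near2; do ?constructor);
  try (by apply: near3; do ?constructor); try (by apply: near4; do ?constructor);
  clear ord near1 near2 near3 near4; try (exfalso; clear -v1 v2; lia);
  rewrite !ell_ivec !mxE in eb eL e'b e'L.
- have vx : cx v = 1 by clear -v1 v2; lia.
  have vy : cy v = -1 by clear -v1 v2; lia.
  rewrite vx vy in eL e'L d1 d2 d3.
  apply: Symmetric12 => [z /on_S[t [_ _]]|x]; first by rewrite !ell_ivec; lra.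
  by rewrite AE !ell_ivec; apply: row2P; rewrite !mxE ?vx ?vy /=; ring.
- have [_ _ _ ? _] := kappas_near.
  have vx : cx v = 1 by clear -v1 v2; lia.
  have vy : cy v = -1 by clear -v1 v2; lia.
  rewrite vx vy in eL e'L d1 d2 d3.
  apply: Symmetric17 => [z /on_S[t [_ _]]|x]; first by rewrite !ell_ivec; lra.
  by rewrite AE !ell_ivec; apply: row2P; rewrite !mxE ?vx ?vy /=; ring.
- have [_ _ _ _ ?] := kappas_near.
  have vx : cx v = 1 by clear -v1 v2; lia.
  rewrite vx in eL e'L d1 d2 d3.
  have k_gt : (-2 < cy v)%R by apply: (lt_intr_scale L0); lra.
  have k_lt : (cy v < 1)%R by apply: (lt_intr_scale L0); lra.
  have [vy|vy] : cy v = 0 \/ cy v = -1 by clear -k_gt k_lt; lia.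
    rewrite vy in eL e'L d1 d2 d3.
    apply: Symmetric18_bottom => [z /on_S[t [_ _ _ _ ->]]|x].
      by rewrite !mxE ?vx ?vy; lra.
    by rewrite AE !ell_ivec; apply: row2P; rewrite !mxE ?vx ?vy /=; ring.
  rewrite vy in eL e'L d1 d2 d3.
  apply: Symmetric18 => [z /on_S[t [_ _ _ _ ->]]|x].
    by rewrite !mxE ?vx ?vy; lra.
  by rewrite AE !ell_ivec; apply: row2P; rewrite !mxE ?vx ?vy /=; ring.
- have [? _ _ _ _] := kappas_near.
  have vx : cx v = 0 by clear -v1 v2; lia.
  have vy : cy v = 1 by clear -v1 v2; lia.
  rewrite vx vy in eL e'L d1 d2 d3.
  apply: Symmetric24 => [z /on_S[t [_ _]]|x]; first by rewrite !ell_ivec; lra.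
  by rewrite AE !ell_ivec; apply: row2P; rewrite !mxE ?vx ?vy /=; ring.
- have [? _ ? _ _] := kappas_near.
  have vx : cx v = 2 by clear -v1 v2; lia.
  have vy : cy v = -3 by clear -v1 v2; lia.
  rewrite vx vy in eL e'L d1 d2 d3.
  by exfalso; lra.
- have [? _ _ ? _] := kappas_near.
  have vx : cx v = 2 by clear -v1 v2; lia.
  have vy : cy v = -3 by clear -v1 v2; lia.
  rewrite vx vy in eL e'L d1 d2 d3.
  by exfalso; lra.
- have [_ ? ? _ _] := kappas_near.
  have vx : cx v = 5 by clear -v1 v2; lia.
  have vy : cy v = -8 by clear -v1 v2; lia.
  rewrite vx vy in eL e'L d1 d2 d3.
  apply: Symmetric56 => [z /on_S[t [_ _]]|x]; first by rewrite !ell_ivec; lra.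
  by rewrite AE !ell_ivec; apply: row2P; rewrite !mxE ?vx ?vy /=; ring.
- have [_ ? _ ? _] := kappas_near.
  have vx : cx v = -3 by clear -v1 v2; lia.
  have vy : cy v = 5 by clear -v1 v2; lia.
  rewrite vx vy in eL e'L d1 d2 d3.
  by exfalso; lra.
- have [? _ _ _ ?] := kappas_near.
  have vx : cx v = -1 by clear -v1 v2; lia.
  have vy : cy v = 2 by clear -v1 v2; lia.
  rewrite vx vy in eL e'L d1 d2 d3.
  by exfalso; lra.
have [_ ? _ _ ?] := kappas_near.
have vx : cx v = -1 by clear -v1 v2; lia.
have vy : cy v = 2 by clear -v1 v2; lia.
rewrite vx vy in eL e'L d1 d2 d3.
by exfalso; lra.
Qed.

Lemma symmetric_probeP Q e' k' : is_symmetric_probe D Q e' k' ->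
  symmetric_spec (probe_set Q) (refl Q e' k').
Proof.
move=> [Qp facet' /ell_facet_interior e'L vQ'].
have [/facetP specQ Db eb vQ1 [L0 DQ]] := probeP Qp.
apply: (symmetric_ends specQ (facetP facet') Db _ eb e'L vQ1 vQ' L0).
- by apply: DQ; rewrite lexx ltW.
- by move=> z [t t_int ->]; split; [apply: DQ | exists t].
by move=> x; rewrite reflE.
Qed.

(** * Displacement by probes and by flags *)

(** The four lines of [probes_through_centre] show this by inspection: beyond
    the centre a probe is still far from the corners as long as it is in
    the triangle, and at twice the parameter of the centre it has crossed the
    slanted side and the fifth, sixth and seventh facets. *)
Lemma ahead_of_centre P t s :
    is_probe D P -> 0 <= t -> near_centre (pbase P + t *: pvec P) -> t <= s ->
    let z := pbase P + s *: pvec P in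
  (8 * cx z + 5 * cy z <= 40 ->
    [/\ 229 / 100 <= cx z, cx z <= 4, 2 <= cy z, cy z <= 6
    & 609 / 100 <= cx z + cy z]) /\
  (2 * t <= s ->
    [/\ 40 < 8 * cx z + 5 * cy z, 16 < 3 * cx z + 2 * cy z,
      25 < 5 * cx z + 3 * cy z & 10 < 2 * cx z + cy z]).
Proof.
move=> Pp t0 u_near ts; have [_ Db eb _ _] := probeP Pp.
move: (u_near) eb => [] + + + /=; have [? ?] := eps_bounds.
rewrite /pvec ellE !mxE.
have [[-> -> -> q3]|[-> -> -> ->]] := probes_through_centre Pp t0 u_near.
  rewrite !ivecE => ux uy eb; move: q3 uy; rewrite !inE.
  by case/or3P=> /eqP -> uy; split=> ?; split; lra.
by rewrite !ivecE => ux uy eb; split=> ?; split; lra.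
Qed.

Lemma not_displaced_by_probe u : near_centre u -> ~ displaced_by_probe D u.
Proof.
move=> u_near [P [Pp [t /andP[t0 tl] defu] close]].
rewrite defu in u_near close; rewrite (daff_facet_probe Pp t0) in close.
have [_ _ _ _ [_ DP]] := probeP Pp.
have /DP/DeltaP[[_ _ le40 _ _] _] : 0 <= 2 * t <= plen P by lra.
have [|_ /(_ (lexx _))[gt40 _ _ _]] := ahead_of_centre (s := 2 * t) Pp t0 u_near.
  by lra.
by move: le40; rewrite leNgt gt40.
Qed.

(** The tip of the continued probe P violates the inequalities 3, 5, 6 and 7, so
    it would be on the outer side of the facet of Q if that were one of these.
    Coming back across the slanted side makes Q steep, and then the integral
    directions left for a probe Q from facet 1, 2, 4 or 8 keep it away from
    the end of P. *)
Lemma not_displaced_by_flag u : near_centre u -> ~ displaced_by_flag D u.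
Proof.
move=> u_near [P [Q [mu [x [x' [l [[Pp Qp PQ] [mu01 l0 Qx Qx' closer]
  [hullD _] [[t /andP[t0 tl] defu] close] [wide short]]]]]]]].
rewrite defu in u_near close; rewrite (daff_facet_probe Pp (ltW t0)) in close.
have [/= tipQ [rho rho0 tipD]] := flag_tip Qp PQ (andP mu01).1 l0 Qx Qx'
  closer hullD wide short.
have [r /andP[r0 _] defr] := PQ.
have tipE : pend P + l *: pvec P = pbase P + (plen P + l) *: pvec P.
  by rewrite /pend -addrA -scalerDl.
rewrite tipE in tipQ tipD.
have tl' : t <= plen P + l by lra.
have [_] := ahead_of_centre Pp (ltW t0) u_near tl'.
case=> [|y3 y5 y6 y7]; first by lra.
have [_ _ _ _ [L0 DP]] := probeP Pp.
have /DP/DeltaP[[_ _ end40 _ _] _] : 0 <= plen P <= plen P by rewrite lexx ltW.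
have [+ _] := ahead_of_centre Pp (ltW t0) u_near (ltW tl).
case=> [//|z1 _ _ _ z3].
have [/facetP specQ DbQ ebQ vQ1 _] := probeP Qp.
move: defr z1 z3; rewrite /pend => -> z1 z3.
have v1 := pairing_int (n := 1) vQ1.
have [? ?] := eps_bounds.
move/DeltaP: DbQ => [[b1 b2 b3 _ _] _].
move: tipQ ebQ; rewrite !ellE.
have steep : (8 * cx (pdir Q) + 5 * cy (pdir Q) < 0)%R.
  move/DeltaP: tipD => [[_ _ tip3 _ _] _].
  rewrite -(ltr_int R) rmorphD !rmorphM /= -(pmulr_rlt0 _ rho0).
  by move: tip3 y3; rewrite /pvec !mxE; lra.
rewrite /pvec !mxE in z1 z3.
clear tl tl' l0 L0 end40 close mu01 t0 closer rho0 tipE tipD.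
clear defu u_near wide short.
move: (pbase P + (plen P + l) *: pvec P) y3 y5 y6 y7 => y y3 y5 y6 y7.
case: specQ v1; rewrite !ivecE => v1 tipQ ebQ.
- clear y3 y5 y6 y7 tipQ.
  have [vx vy] : cx (pdir Q) = 1 /\ (cy (pdir Q) <= -2)%R.
    by clear -v1 steep; lia.
  have : r * (cy (pdir Q))%:~R <= r * (-2)%:~R by rewrite ler_wpM2l // ler_int.
  by rewrite vx in z1 z3; lra.
- clear y3 y5 y6 y7 tipQ.
  have [vx vy] : (cx (pdir Q) <= -1)%R /\ cy (pdir Q) = 1.
    by clear -v1 steep; lia.
  have : r * (cx (pdir Q))%:~R <= r * (-1)%:~R by rewrite ler_wpM2l // ler_int.
  by rewrite vy in z3; lra.
- by clear y5 y6 y7; lra.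
- have [? _ _ _ _] := kappas_near; clear y3 y5 y6 y7 tipQ.
  have [vx vy] : (cx (pdir Q) <= 1)%R /\ cy (pdir Q) = - 1 - cx (pdir Q).
    by clear -v1 steep; lia.
  have : r * (cx (pdir Q))%:~R <= r * 1%:~R by rewrite ler_wpM2l // ler_int.
  by rewrite vy in z3; move: z3; rewrite rmorphB rmorphN /=; lra.
- by have [_ ? _ _ _] := kappas_near; clear y3 y6 y7 z1 z3 ebQ b1 b2 b3; lra.
- by have [_ _ ? _ _] := kappas_near; clear y3 y5 y7 z1 z3 ebQ b1 b2 b3; lra.
- by have [_ _ _ ? _] := kappas_near; clear y3 y5 y6 z1 z3 ebQ b1 b2 b3; lra.
have [_ _ _ _ ?] := kappas_near; clear y3 y5 y6 y7 tipQ.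
have [vx vy] : cx (pdir Q) = -1 /\ (cy (pdir Q) <= 1)%R.
  by clear -v1 steep; lia.
have : r * (cy (pdir Q))%:~R <= r * 1%:~R by rewrite ler_wpM2l // ler_int.
by rewrite vx in z1 z3; lra.
Qed.

(** * Displacement by symmetric probes *)

Lemma between_gt (p q c : R) b w s a : 0 <= s <= a ->
    c < p * cx b + q * cy b ->
    c < p * cx (b + a *: w) + q * cy (b + a *: w) ->
  c < p * cx (b + s *: w) + q * cy (b + s *: w).
Proof.
rewrite !mxE => /andP[s0 sa] cb cu.
have [g0|g0] := leP 0 (p * cx w + q * cy w).
  by have := mulr_ge0 s0 g0; lra.
by have := ler_wnM2r (ltW g0) sa; lra.
Qed.

Lemma reflect_ahead Q e' k' P s :
  refl Q e' k' (pend P) + s *: refl_lin Q e' (pvec P)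
  = refl Q e' k' (pbase P + (plen P + s) *: pvec P).
Proof. by rewrite -refl_line /pend -addrA -scalerDl. Qed.

(** A symmetric probe that meets a probe beyond the centre can only be the one
    along the third facet. Its reflection preserves the distance to that facet,
    so the reflected probe leaves the triangle as soon as the original one. *)
Lemma not_displaced_before_reflection Q e' k' P l t :
    is_symmetric_probe D Q e' k' -> is_probe D P -> probe_set Q (pend P) ->
    (forall s, 0 <= s <= l ->
      D (refl Q e' k' (pend P) + s *: refl_lin Q e' (pvec P))) ->
    0 <= l -> near_centre (pbase P + t *: pvec P) -> 0 <= t <= plen P ->
  ~ t < (plen P + l) / 2.
Proof.
move=> Qsym Pp PQ Dl l0 u_near /andP[t0 tl] close.
have [_ _ _ _ [L0 DP]] := probeP Pp.
have /DP/DeltaP[[_ _ end40 _ _] _] : 0 <= plen P <= plen P by rewrite lexx ltW.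
have [+ _] := ahead_of_centre Pp t0 u_near tl.
case=> [//|z1 z1' z2 z2' z3].
case: (symmetric_probeP Qsym)
  => [nearQ|nearQ|nearQ AE|nearQ AE|nearQ AE|nearQ AE|nearQ AE|_ AE].
- by have := nearQ _ PQ; rewrite /pend; clear z1 z2 z2' z3; lra.
- by have := nearQ _ PQ; rewrite /pend; clear z1 z1' z2 z3; lra.
- by have := nearQ _ PQ; rewrite /pend; clear z1 z1' z2 z2'; lra.
- by have := nearQ _ PQ; rewrite /pend; clear z1 z1' z2 z2'; lra.
- by have := nearQ _ PQ; rewrite /pend; clear z1 z1' z2 z2'; lra.
- by have := nearQ _ PQ; rewrite /pend; clear z1 z1' z2' z3; lra.
- by have := nearQ _ PQ; rewrite /pend; clear z1' z2 z2' z3; lra.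
clear z1 z1' z2 z2' z3.
have /Dl : 0 <= l <= l by rewrite l0 lexx.
rewrite reflect_ahead AE => /DeltaP[[_ _ + _ _] _].
have tl' : t <= plen P + l by lra.
have [_] := ahead_of_centre Pp t0 u_near tl'.
case=> [|y3 _ _ _]; first by lra.
move: (pbase P + (plen P + l) *: pvec P) y3 => y y3.
by rewrite !pointE; lra.
Qed.

(** The reflection is an involution over the integers, so applying it once more
    turns a Bezout relation for v into one for the image of v. *)
Lemma primitive_refl Q e' (v : 'rV[int]_2) :
    pairing (pnormal Q) (pvec Q) = 1 -> pairing e' (pvec Q) = -1 ->
    primitive v ->
  exists2 v' : 'rV[int]_2, primitive v' &
    refl_lin Q e' (to_plane R v) = to_plane R v'.
Proof.
move=> vQ1 vQ' /coprimezP[[m n] /= mn].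
pose f := e' - pnormal Q.
pose r (w : 'rV[int]_2) : int := cx f * cx w + cy f * cy w.
have rQ : r (pdir Q) = -2.
  have w1 := pairing_int (n := 1) vQ1; have w2 := pairing_int (n := -1) vQ'.
  transitivity ((cx e' * cx (pdir Q) + cy e' * cy (pdir Q))
      - (cx (pnormal Q) * cx (pdir Q) + cy (pnormal Q) * cy (pdir Q))).
    by rewrite /r /f !mxE; ring.
  by rewrite w1 w2.
have r_lin (w1 w2 : 'rV[int]_2) (c : int) : r (w1 + c *: w2) = r w1 + c * r w2.
  by rewrite /r !mxE; ring.
pose v' := v + r v *: pdir Q.
have rv' : r v' = - r v by rewrite r_lin rQ; ring.
exists v'.
  apply/coprimezP; exists (m + cx f * (m * cx (pdir Q) + n * cy (pdir Q)),
    n + cy f * (m * cx (pdir Q) + n * cy (pdir Q))) => /=.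
  transitivity (m * (cx v' + r v' * cx (pdir Q))
      + n * (cy v' + r v' * cy (pdir Q))).
    by rewrite /r; ring.
  by rewrite rv' -mn /v' !mxE; ring.
rewrite /refl_lin /v' /r /f; apply: row2P; rewrite pairingE !mxE;
  by rewrite !(rmorphD, rmorphM, rmorphN) /=; ring.
Qed.

(** A base point lies on a side of the triangle, or on a cut and hence close to
    A or to B. *)
Variant base_spec b : 'rV[int]_2 -> R -> Prop :=
| Base1 of cx b = 0 : base_spec b (ivec 1 0) 0
| Base2 of cy b = 0 : base_spec b (ivec 0 1) 0
| Base3 of 8 * cx b + 5 * cy b = 40 : base_spec b (ivec (-8) (-5)) 40
| BaseA e k of 99 / 20 <= cx b : base_spec b e k
| BaseB e k of 79 / 10 <= cy b : base_spec b e k.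

Lemma baseP P : is_probe D P -> base_spec (pbase P) (pnormal P) (pconst P).
Proof.
move=> /probeP[/facetP spec Db eb _ _]; have [? ?] := eps_bounds.
have nearA e k : cutA e k -> ell e k (pbase P) = 0 -> base_spec (pbase P) e k.
  move=> cut e0; apply: BaseA; have := cutA_near cut Db.
  by rewrite e0; lra.
have nearB e k : cutB e k -> ell e k (pbase P) = 0 -> base_spec (pbase P) e k.
  move=> cut e0; apply: BaseB; have := cutB_near cut Db.
  by rewrite e0; lra.
case: spec eb => eb; try (by apply: nearA; first constructor);
  try (by apply: nearB; first constructor); constructor;
  by move: eb; rewrite ell_ivec; lra.
Qed.

(** Let xbar be the point of the line of P that the reflection maps to u. Its
    parameter a on P is its distance to the facet of P, and also the length
    that has to be available beyond u. So the reflected point with parameter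
    2 a, the mirror image in u of the reflected base, lies in D. Near A and B
    the reflected probe leaves D soon after u. For the six explicit
    reflections the end of P lies in a narrow strip that does not contain xbar,
    which by convexity confines the base to the same side; with the
    inequalities for the mirror image, each facet for the base is then
    impossible, or forces a coordinate of the direction into an interval
    without a suitable integer. *)
Lemma not_displaced_after_reflection Q e' k' P l d u :
    is_symmetric_probe D Q e' k' -> is_probe D P -> probe_set Q (pend P) ->
    (forall s, 0 <= s <= l ->
      D (refl Q e' k' (pend P) + s *: refl_lin Q e' (pvec P))) ->
    near_centre u -> u = refl Q e' k' (pend P) + d *: refl_lin Q e' (pvec P) ->
    0 < d ->
  ~ plen P + d < (plen P + l) / 2.
Proof.
move=> Qsym Pp PQ Dl [ux uy] defu d0 close.
have [_ Db eb vP1 [L0 _]] := probeP Pp.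
pose a := plen P + d; have a0 : 0 < a by rewrite addr_gt0.
have La : 0 <= plen P <= a by rewrite ltW //= lerDl ltW.
have Dm : D (refl Q e' k' (pbase P + (a + a) *: pvec P)).
  have : D (refl Q e' k' (pend P) + (plen P + d + d) *: refl_lin Q e' (pvec P)).
    by apply: Dl; lra.
  rewrite reflect_ahead (_ : plen P + (plen P + d + d) = a + a) //.
  by rewrite /a; ring.
have Dm' : D (refl Q e' k' (pend P) + (d + d) *: refl_lin Q e' (pvec P)).
  by apply: Dl; lra.
have x'Q : probe_set Q (refl Q e' k' (pend P)).
  have [r /andP[r0 rL] ->] := PQ.
  rewrite (refl_symmetric_probe _ Qsym); exists (plen Q - r) => //.
  by rewrite subr_ge0 rL gerBl.
have ea := ell_segment a vP1 eb.
have := defu; rewrite reflect_ahead -/a => defu'.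
have mx : cx (pbase P + (a + a) *: pvec P)
    = 2 * cx (pbase P + a *: pvec P) - cx (pbase P) by rewrite !mxE; ring.
have my : cy (pbase P + (a + a) *: pvec P)
    = 2 * cy (pbase P + a *: pvec P) - cy (pbase P) by rewrite !mxE; ring.
have base_le (p q c : R) : p * cx (pend P) + q * cy (pend P) <= c ->
    c < p * cx (pbase P + a *: pvec P) + q * cy (pbase P + a *: pvec P) ->
    p * cx (pbase P) + q * cy (pbase P) <= c.
  move=> end_le far; rewrite leNgt; apply: contraTN end_le => base_gt.
  by rewrite -ltNge (between_gt La base_gt far).
have Xv : cx (pbase P + a *: pvec P) = cx (pbase P) + a * (cx (pdir P))%:~R.
  by rewrite !mxE.
have Yv : cy (pbase P + a *: pvec P) = cy (pbase P) + a * (cy (pdir P))%:~R.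
  by rewrite !mxE.
have v1 := pairing_int (n := 1) vP1.
have {}ea : (cx (pnormal P))%:~R * cx (pbase P + a *: pvec P)
  + (cy (pnormal P))%:~R * cy (pbase P + a *: pvec P) + pconst P = a.
  by rewrite -ellE.
have base_in := baseP Pp.
have spec := symmetric_probeP Qsym.
case: spec => [nearQ|nearQ|nearQ AE|nearQ AE|nearQ AE|nearQ AE|nearQ AE|nearQ AE].
- move/nearQ: x'Q; move/DeltaP: Dm' => [[+ _ _ _ _] _]; move: ux.
  have [_ ?] := eps_bounds.
  rewrite defu; move: (refl Q e' k' (pend P)) (refl_lin Q e' (pvec P)) => x' w'.
  by rewrite !mxE; lra.
- move/nearQ: x'Q; move/DeltaP: Dm' => [[_ + _ _ _] _]; move: uy.
  have [_ ?] := eps_bounds.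
  rewrite defu; move: (refl Q e' k' (pend P)) (refl_lin Q e' (pvec P)) => x' w'.
  by rewrite !mxE; lra.
all: clear Dm' x'Q close Dl La L0 d0; move/nearQ: PQ => PQ; clear nearQ.
all: move/DeltaP: Db => [[b1 b2 b3 _ _] _]; move: ux uy Dm.
all: rewrite defu' !AE => ux uy /DeltaP[[m1 m2 m3 _ _] _].
all: rewrite !pointE mx my in ux uy m1 m2 m3.
all: clear defu defu' AE mx my eb.
all: move: (pbase P + a *: pvec P) Xv Yv base_le ea ux uy m1 m2 m3
  => xbar Xv Yv base_le ea ux uy m1 m2 m3.
all: have [e_gt0 e_small] := eps_bounds.
- have := base_le 1 1 (51 / 10) ltac:(lra) ltac:(lra) => {base_le PQ} base.
  case: base_in ea v1 => [b0|b0|b0|e k b0|e k b0] ea v1; rewrite ?ivecE in ea v1.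
  + have v_gt : (-1 < cy (pdir P))%R by apply: (lt_intr_scale a0); lra.
    have v_lt : (cy (pdir P) < 0)%R by apply: (lt_intr_scale a0); lra.
    by clear -v1 v_gt v_lt; lia.
  + by clear Xv Yv; lra.
  + by clear Xv Yv; lra.
  + by clear Xv Yv ea a0; lra.
  + by clear Xv Yv ea a0; lra.
- have [_ _ _ k_near _] := kappas_near.
  have := base_le 1 1 (51 / 10) ltac:(lra) ltac:(lra) => {base_le PQ} base.
  by case: base_in ea v1 => [b0|b0|b0|e k b0|e k b0] ea v1;
    rewrite ?ivecE in ea v1; clear Xv Yv; lra.
- have [_ _ _ _ k_near] := kappas_near.
  have := base_le 1 1 (51 / 10) ltac:(lra) ltac:(lra) => {base_le PQ} base.
  by case: base_in ea v1 => [b0|b0|b0|e k b0|e k b0] ea v1;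
    rewrite ?ivecE in ea v1; clear Xv Yv; lra.
- have [_ _ _ _ k_near] := kappas_near.
  have := base_le 0 1 (1 / 10) ltac:(lra) ltac:(lra) => {base_le PQ} base.
  case: base_in ea v1 => [b0|b0|b0|e k b0|e k b0] ea v1; rewrite ?ivecE in ea v1.
  + by clear Xv Yv; lra.
  + have v_gt : (0 < cx (pdir P))%R by apply: (lt_intr_scale a0); lra.
    have v_lt : (cx (pdir P) < 1)%R by apply: (lt_intr_scale a0); lra.
    by clear -v1 v_gt v_lt; lia.
  + by clear Xv Yv; lra.
  + by clear Xv Yv ea a0; lra.
  + by clear Xv Yv ea a0; lra.
- have [k_near _ _ _ _] := kappas_near.
  have := base_le 1 0 (1 / 10) ltac:(lra) ltac:(lra) => {base_le PQ} base.
  case: base_in ea v1 => [b0|b0|b0|e k b0|e k b0] ea v1; rewrite ?ivecE in ea v1.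
  + have v_gt : (0 < cy (pdir P))%R by apply: (lt_intr_scale a0); lra.
    have v_lt : (cy (pdir P) < 1)%R by apply: (lt_intr_scale a0); lra.
    by clear -v1 v_gt v_lt; lia.
  + by clear Xv Yv; lra.
  + by clear Xv Yv; lra.
  + by clear Xv Yv ea a0; lra.
  + by clear Xv Yv ea a0; lra.
have [_ k5n k6n _ _] := kappas_near.
have := base_le (-8) (-5) (- (399 / 10)) ltac:(lra) ltac:(lra).
move=> {base_le PQ} base.
case: base_in ea v1 => [b0|b0|b0|e k b0|e k b0] ea v1; rewrite ?ivecE in ea v1.
+ by clear Xv Yv; lra.
+ by clear Xv Yv; lra.
+ have v_gt : (0 < cx (pdir P))%R by apply: (lt_intr_scale a0); lra.
  have v_lt : (cx (pdir P) < 3)%R by apply: (lt_intr_scale a0); lra.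
  by clear -v1 v_gt v_lt; lia.
+ by clear Xv Yv ea a0; lra.
+ by clear Xv Yv ea a0; lra.
Qed.

Lemma not_displaced_by_symmetric u :
  near_centre u -> ~ displaced_by_symmetric D u.
Proof.
move=> u_near [Q [e' [k' [P [l [Qsym [Pp [r r_in defr]] [l0 segD]]]]]]].
have PQ : probe_set Q (pend P).
  by case/andP: r_in => r0 rL; exists r; rewrite ?(ltW r0) ?(ltW rL).
have Dl s : 0 <= s <= l ->
    D (refl Q e' k' (pend P) + s *: refl_lin Q e' (pvec P)).
  by move=> s_in; apply: segD; exists s.
case=> [[[t /andP[t0 tL] defu]]|[[d /andP[d0 dl] defu]]].
  rewrite defu (daff_facet_probe Pp (ltW t0)) => close.
  apply: (not_displaced_before_reflection Qsym Pp PQ Dl l0 _ _ close).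
    by rewrite -defu.
  by rewrite !ltW.
have [[_ _ [prP _] _] [/probeP[_ _ _ vQ1 _] _ _ vQ']] := (Pp, Qsym).
have [v' prv' defv'] := primitive_refl vQ1 vQ' prP.
rewrite (daffE (s := - d) prv'); last first.
  by rewrite defu defv' opprD addrA subrr add0r scaleNr.
rewrite normrN (gtr0_norm d0).
exact: (not_displaced_after_reflection Qsym Pp PQ Dl u_near defu d0).
Qed.

Lemma open_set_around_centre : (edges D #= `I_8)%card ->
  exists U : set 'rV[R]_2, [/\ open U, U !=set0, U `<=` D°
    & forall u, U u -> trivial_qW D u /\ ~ displaceable_by_extended_probes D u].
Proof.
move=> edges8.
have near_c u : ball (point (23 / 10) (19 / 5)) eps u -> near_centre u.
  move=> [_ c_u]; have := (c_u ord0 ord0, c_u ord0 ord_max).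
  rewrite /ball /= !pointE !ltr_distlC => -[/andP[? ?] /andP[? ?]].
  by split; apply/andP; split; lra.
exists (ball (point (23 / 10) (19 / 5)) eps); split.
- exact: ball_open.
- by exists (point (23 / 10) (19 / 5)); apply: ballxx.
- rewrite -open_subsetE; last exact: ball_open.
  move=> u /near_c[ux uy]; apply/DeltaP.
  have [? ? ? ? ?] := kappas_near; have [? ?] := eps_bounds.
  by split; split; lra.
move=> u /near_c u_near; split.
  apply: (trivial_qW_unique_nearest (facet5 edges8)) => e k e0 pos.
  exact: nearest_facet (facet5 edges8) u_near e0 pos.
case; first exact: not_displaced_by_probe.
  exact: not_displaced_by_symmetric.
exact: not_displaced_by_flag.
Qed.

End Polygon.

(** * The theorem *)

Theorem proposition4p6p4 (R : realType) :
  exists e : R, 0 < e /\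
    forall k4 k5 k6 k7 k8 : R,
      8 - e < k4 < 8 -> 16 - e < k5 < 16 -> 25 - e < k6 < 25 ->
      10 - e < k7 < 10 -> 5 - e < k8 < 5 ->
      (edges (Delta_bar k4 k5 k6 k7 k8) #= `I_8)%card ->
      exists U : set 'rV[R]_2,
        [/\ open U, U !=set0, U `<=` (Delta_bar k4 k5 k6 k7 k8)°
          & forall u, U u ->
              trivial_qW (Delta_bar k4 k5 k6 k7 k8) u /\
              ~ displaceable_by_extended_probes (Delta_bar k4 k5 k6 k7 k8) u].
Proof.
have e0 : 0 < (40 * 50)^-1 :> R by rewrite invr_gt0 mulr_gt0 ?ltr0n.
have e1 : 40 * (50 * (40 * 50)^-1) <= 1 :> R.
  by rewrite mulrA divff ?mulf_neq0 ?pnatr_eq0.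
exists (40 * 50)^-1; split=> // k4 k5 k6 k7 k8 k4n k5n k6n k7n k8n edges8.
exact: (open_set_around_centre e0 e1 k4n k5n k6n k7n k8n edges8).
Qed.
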